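(* There exist positive real universal constants $A$, $B_1$, $B_2$, $B_3$ and $B_4$ such that for any positive real constants $\alpha>1$, $d$ and $\delta$ ($\delta\neq1$), for any prior distribution $\pi\in\mathcal M_+^1(\Theta)$ and any $\epsilon\in(0,1)$, with $\mathbb P$ probability at least $1-\epsilon$, for any $\beta,\gamma\in\Lambda_\alpha=\{\alpha^k:k\in\mathbb N,0\le k<\frac{\log N}{\log\alpha}\}$ such that $$\sup_{\beta'\in\mathbb R,\ \beta'\ge\beta}\Bigl|\frac{\beta'}{d}\bigl[\pi_{\exp(-\beta'R)}(R)-\inf_\Theta R\bigr]-1\Bigr|\le\delta$$ and such that also, for some positive real parameter $x$, $$\frac{\gamma\max\{x,1\}}{N}\le\frac{A\beta}{\gamma}\quad\text{and}\quad\frac\beta\gamma\le\frac{B_1}{B_2\frac{1+\delta}{1-\delta}+\frac{B_4\frac{\gamma^2}{N}\varphi(x)-2B_3\log(\epsilon)+4B_3\log\bigl[\frac{\log(N)}{\log(\alpha)}\bigr]}{(1-\delta)d}},$$ the bound $B(\pi_{\exp(-\frac\gamma2r)},\beta,\gamma)$ defined in the context, with $\nu$ chosen to be the uniform probability measure on $\Lambda_\alpha$, satisfies $B(\pi_{\exp(-\frac\gamma2 r)},\beta,\gamma)\le0$, so that $\widehat\beta(\pi_{\exp(-\frac\gamma2r)})\ge\beta$, and therefore $$\pi_{\exp(-\gamma\frac r2)}(R)\le\pi_{\exp(-\beta R)}(R)\le\inf_\Theta R+\frac{(1+\delta)d}{\beta}.$$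
   Context: Setting. $N\ge1$ is an integer, $(\mathcal X,\mathcal B)$ a measurable space, $\mathcal Y$ a finite set, $\Omega=(\mathcal X\times\mathcal Y)^N$ with coordinate process $(X_i,Y_i)_{i=1}^N$, and $\mathbb P=\bigotimes_{i=1}^NP_i$ a product probability measure. $(\Theta,\mathcal T)$ is a measurable space, $\{f_\theta:\mathcal X\to\mathcal Y;\theta\in\Theta\}$ is jointly measurable. $R(\theta)=\frac1N\sum_{i=1}^N\mathbb P[f_\theta(X_i)\ne Y_i]$, $r(\theta)=\frac1N\sum_{i=1}^N\mathbf 1[f_\theta(X_i)\ne Y_i]$, $m'(\theta,\theta')=\frac1N\sum_{i=1}^N|\mathbf 1[f_\theta(X_i)\ne Y_i]-\mathbf 1[f_{\theta'}(X_i)\ne Y_i]|$, $M'(\theta,\theta')=\mathbb P[m'(\theta,\theta')]$. It is assumed that there is $\widetilde\theta\in\Theta$ with $R(\widetilde\theta)=\inf_\Theta R$; the expected margin function is $$\varphi(x)=\sup_{\theta\in\Theta}\bigl\{M'(\theta,\widetilde\theta)-x[R(\theta)-R(\widetilde\theta)]\bigr\},\quad x\in\mathbb R_+.$$ $\rho(h)=\int h\,d\rho$, $\rho(m')$ is the function $\theta\mapsto\int m'(\theta,\theta')\rho(d\theta')$, $\frac{d\pi_{\exp(h)}}{d\pi}=\frac{\exp(h)}{\pi[\exp(h)]}$, $\mathcal K$ is the Kullback divergence; posterior distributions are regular conditional probability measures $\Omega\to\mathcal M_+^1(\Theta)$. $F_{\gamma,a}(x)=-N\log[1-\tanh(\frac\gamma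 N)x]-a x$; for $a<N\tanh(\frac\gamma N)$, $F^{-1}_{\gamma,a}$ is the inverse of the increasing bijection $F_{\gamma,a}:[0,\tanh(\gamma/N)^{-1})\to[0,\infty)$. For an atomic probability measure $\nu$ on $\mathbb R_+$, a posterior distribution $\rho$ and $\beta,\gamma>0$, $$\begin{aligned}B(\rho,\beta,\gamma)=\inf_{\lambda_1,\lambda_2}\Bigl\{&\mathcal K[\rho,\pi_{\exp(-\lambda_1 r)}]+(\gamma-\lambda_1)[\rho(r)-\pi_{\exp(-\lambda_2 r)}(r)]\\&+\log\bigl\{\pi_{\exp(-\lambda_1 r)}\bigl[\exp\{N\log[\cosh(\tfrac{\gamma}{N})]\rho(m')\}\bigr]\bigr\}-\log[\epsilon\nu(\{\beta\})\nu(\{\gamma\})]\\&+(\gamma-\lambda_1)\tfrac{\beta}{\lambda_2}F^{-1}_{\gamma,\frac{\beta\gamma}{\lambda_2}}\Bigl[\log\bigl\{\pi_{\exp(-\lambda_2 r)}\bigl[\exp\{N\log[\cosh(\tfrac{\gamma}{N})]\pi_{\exp(-\lambda_2 r)}(m')\}\bigr]\bigr\}-\log[\epsilon\nu(\{\beta\})\nu(\{\gamma\})]\Bigr]\Bigr\},\end{aligned}$$ the infimum being over $0\le\lambda_1\le\gamma$ and $\lambda_2>\frac{\beta\gamma}{N}\tanh(\frac\gamma N)^{-1}$. Finally $$\widehat\beta(\rho)=\sup\bigl\{\beta\in\mathbb R:\inf_{\gamma,\ N\tanh(\frac\gamma N)>\beta}B(\rho,\beta,\gamma)\le0\bigr\}.$$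 ''Universal'' means not depending on any other object in the statement.
   Formalization: The additional assumption α ≤ N (so that log(N)/log(α) ≥ 1) is made; without it the claim is false, since for large α the grid Λ_α is {1} while log[log(N)/log(α)] tends to −∞. *)

(* Defs.v *)
From HB Require Import structures.
From mathcomp Require Import all_boot all_order all_algebra.
From mathcomp Require Import all_classical all_reals all_analysis.
From mathcomp Require Import measurable_realfun.

Set Implicit Arguments.
Unset Strict Implicit.
Unset Printing Implicit Defensive.

Import Order.TTheory GRing.Theory Num.Theory.
Import numFieldNormedType.Exports.

Local Open Scope classical_set_scope.
Local Open Scope ring_scope.

Section hyperbolic.
Context {R : realType}.

Definition cosh (x : R) : R := (expR x + expR (- x)) / 2.
Definition tanh (x : R) : R :=
  (expR x - expR (- x)) / (expR x + expR (- x)).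

End hyperbolic.

(* [P] is the product of the [p i]; the tuple type carries the sigma-algebra
   generated by the coordinates, on which this determines [P]. *)
Definition is_product_measure {R : realType} {d : measure_display}
    {T : measurableType d} {N : nat} (p : 'I_N -> probability T R)
    (P : probability (N.-tuple T) R) : Prop :=
  forall A : 'I_N -> set T, (forall i, measurable (A i)) ->
    P [set w | forall i, A i (tnth w i)] = (\prod_(i < N) p i (A i))%E.

Section exp_measure.
Local Open Scope ereal_scope.
Context {R : realType} {d : measure_display} {T : measurableType d}.
Variables (mu : probability T R) (h : T -> R).

Definition exp_measure of measurable_fun [set: T] h : set T -> \bar R :=
  fun A => \int[mu]_(x in A) (expR (h x))%:E.

Hypothesis mh : measurable_fun [set: T] h.

Local Notation nu := (exp_measure mh).

Let nu0 : nu set0 = 0.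
Proof. by rewrite /exp_measure integral_set0. Qed.

Let nu_ge0 A : 0 <= nu A.
Proof. by apply: integral_ge0 => x _; rewrite lee_fin expR_ge0. Qed.

Let nu_sigma_additive : semi_sigma_additive nu.
Proof.
move=> /= F mF tF mUF; rewrite /exp_measure; apply: cvg_toP.
  apply: ereal_nondecreasing_is_cvgn => m n mn.
  apply: lee_sum_nneg_natr => // k _ _; apply: integral_ge0 => /= x Fkx.
  by rewrite lee_fin expR_ge0.
rewrite ge0_integral_bigcup//=.
apply: measurable_funTS; apply/measurable_EFinP.
exact: (measurableT_comp (@measurable_expR R)).
Qed.

HB.instance Definition _ := isMeasure.Build _ _ _ nu
  nu0 nu_ge0 nu_sigma_additive.

End exp_measure.

(* The probability measure with density exp(h) / mu[exp(h)] with respect to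
   [mu]. It is [mu] itself when h is not measurable or exp(h) not integrable,
   which never happens below: there h is measurable and bounded. *)
Definition gibbs {R : realType} {d : measure_display} {T : measurableType d}
    (mu : probability T R) (h : T -> R) : probability T R :=
  if pselect (measurable_fun [set: T] h) is left mh
  then mnormalize (exp_measure mu mh) mu else mu.

(* Kullback divergence: rho[log(d rho / d mu)] if rho << mu, and +oo otherwise;
   [lne] is the extended logarithm, with [lne 0 = -oo]. *)
Definition kullback {R : realType} {d : measure_display} {T : measurableType d}
    (rho mu : probability T R) : \bar R :=
  if `[< rho `<< mu >]
  then (\int[rho]_x lne (Radon_Nikodym (charge_of_finite_measure rho) mu x))%E
  else +oo%E.

Section classification.
Context {R : realType} {dX dY dT : measure_display}.
Context {X : measurableType dX} {Y : measurableType dY}.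
Context {Theta : measurableType dT} {N : nat}.
Variable f : Theta -> X -> Y.

(* 1[f_theta(X_i) <> Y_i] on the sample [w] *)
Definition err (w : N.-tuple (X * Y)%type) (th : Theta) (i : 'I_N) : R :=
  (f th (tnth w i).1 != (tnth w i).2)%:R.

Definition emp_risk (w : N.-tuple (X * Y)%type) (th : Theta) : R :=
  N%:R^-1 * \sum_(i < N) err w th i.

Definition emp_margin (w : N.-tuple (X * Y)%type) (th th' : Theta) : R :=
  N%:R^-1 * \sum_(i < N) `|err w th i - err w th' i|.

Variable P : probability (N.-tuple (X * Y)%type) R.

Definition risk (th : Theta) : R :=
  N%:R^-1 *
  \sum_(i < N) fine (P [set w | f th (tnth w i).1 != (tnth w i).2]).

Definition margin (th th' : Theta) : R :=
  \int[P]_w emp_margin w th th'.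

Definition margin_fun (tht : Theta) (x : R) : R :=
  sup [set margin th tht - x * (risk th - risk tht) | th in [set: Theta]].

End classification.

Section inverse.
Context {R : realType}.
Variables (N : nat) (gamma a : R).

Definition F_fun (x : R) : R :=
  - N%:R * ln (1 - tanh (gamma / N%:R) * x) - a * x.

(* inverse of the bijection F_fun : [0, 1/tanh(gamma/N)[ -> [0, +oo[, extended
   at +oo by its limit *)
Definition F_inv (y : \bar R) : \bar R :=
  if y is z%:E
  then ('pinv_(fun=> 0)
          [set x : R | 0 <= x < (tanh (gamma / N%:R))^-1] F_fun z)%:E
  else ((tanh (gamma / N%:R))^-1)%:E.

End inverse.

Section bound.
Context {R : realType} {dX dY dT : measure_display}.
Context {X : measurableType dX} {Y : measurableType dY}.
Context {Theta : measurableType dT} {N : nat}.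
Variables (f : Theta -> X -> Y) (pi : probability Theta R) (eps : R).
Variable nu : probability (measurableTypeR R) R.
Variable w : N.-tuple (X * Y)%type.

Local Notation r := (emp_risk f w).
Local Notation m' := (emp_margin f w).
Local Notation post l := (gibbs pi (fun th => - l * r th)).

(* - log[eps nu({beta}) nu({gamma})], equal to +oo if beta or gamma is not an
   atom of nu *)
Definition penalty (beta gamma : R) : \bar R :=
  (- lne (eps%:E * nu [set beta] * nu [set gamma]))%E.

(* log{mu[exp{N log[cosh(gamma/N)] rho(m')}]} *)
Definition log_laplace_margin (gamma : R) (mu rho : probability Theta R) : R :=
  ln (\int[mu]_th expR (N%:R * ln (cosh (gamma / N%:R)) *
                          \int[rho]_th' m' th th')).

Definition B_expr (rho : probability Theta R) (beta gamma l1 l2 : R) : \bar R :=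
  (kullback rho (post l1)
   + ((gamma - l1) * (\int[rho]_th r th - \int[post l2]_th r th)%R)%:E
   + (log_laplace_margin gamma (post l1) rho)%:E
   + penalty beta gamma
   + ((gamma - l1) * (beta / l2))%:E *
     F_inv N gamma (beta * gamma / l2)
       ((log_laplace_margin gamma (post l2) (post l2))%:E
        + penalty beta gamma))%E.

(* [rho] stands for the value at the sample [w] of a posterior distribution. *)
Definition B_bound (rho : probability Theta R) (beta gamma : R) : \bar R :=
  ereal_inf [set B_expr rho beta gamma l.1 l.2 | l in
    [set l : R * R | 0 <= l.1 <= gamma /\
                     beta * gamma / N%:R * (tanh (gamma / N%:R))^-1 < l.2]].

(* For beta <= 0 the infimum is +oo when nu is carried by the positive reals,
   because of [penalty], so such beta do not contribute. *)
Definition beta_hat (rho : probability Theta R) : \bar R :=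
  ereal_sup [set beta%:E | beta in
    [set beta : R |
      (ereal_inf [set B_bound rho beta gamma | gamma in
         [set gamma : R | (beta < N%:R * tanh (gamma / N%:R))%R]] <= 0)%E]].

End bound.

Section grid.
Context {R : realType}.
Variables (N : nat) (alpha : R).

Definition grid : set R :=
  [set alpha ^+ k | k in [set k : nat | k%:R < ln (N%:R : R) / ln alpha]].

Lemma measurable_grid : measurable (grid : set (measurableTypeR R)).
Proof.
apply: countable_measurable; first by move=> x; exact: measurable_set1.
apply: (@sub_countable _ _ _ [set k : nat | k%:R < ln (N%:R : R) / ln alpha]).
  exact: card_image_le.
exact: countableP.
Qed.

(* The uniform probability measure on the grid; when N = 1 the grid is empty
   and this is by convention the Dirac mass at 1. *)
Definition grid_uniform : probability (measurableTypeR R) R :=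
  mnormalize (mrestr (@counting (measurableTypeR R) R) measurable_grid)
             (@dirac _ (measurableTypeR R) 1 R).

End grid.

(* Main.v *)
(* Write r', R', m', M' for the risks and margins relative to [tht], and
   Z(a) = log pi[exp(- a R')], z(a) = log pi[exp(- a r')]. By independence,
   E[exp(t r' + s m')] <= exp(t R' + 9 gamma^2/N M') when |t| <= gamma and
   0 <= s <= 2 gamma^2/N, so by Fubini and Markov, off an event of probability
   at most eps, finitely many transforms log pi[exp(- u R' + t r' + s m')] are at
   most log pi[exp(- (u - t) R' + 9 gamma^2/N M')] + D simultaneously. Since
   M' <= x R' + phi(x), the last transform is at most Z(u - t - beta/2) + W, where
   W = 9 gamma^2/N phi(x) + D.

   Gibbs means are bounded by differences of log-Laplace transforms (Jensen), and
   the hypothesis on pi_{exp(- beta' R)} controls differences of Z. With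
   lambda_1 = gamma/2 the divergence in B vanishes, and with lambda_2 = 2 beta every
   term of B is O((1 + delta) d + W) except - gamma/2 pi_{exp(- 2 beta r)}(r'), which
   is at most - (gamma/beta) (1 - delta) d / 8 + O((1 + delta) d + W). The latter
   needs |z(a) - Z(a)| <= (a/gamma) O((1 + delta) d + W) for a = 2 beta, 4 beta, which
   follows from the deviations at temperature gamma by convexity. The condition
   on beta/gamma makes the negative term dominate. *)

Require Import Defs.
From mathcomp Require Import all_boot all_order all_algebra.
From mathcomp Require Import finmap.
From mathcomp Require Import all_classical all_reals all_analysis.
From mathcomp Require Import measurable_realfun.
From mathcomp Require Import ring lra.

Set Implicit Arguments.
Unset Strict Implicit.
Unset Printing Implicit Defensive.

Import Order.TTheory GRing.Theory Num.Theory.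
Import numFieldNormedType.Exports.

Local Open Scope classical_set_scope.
Local Open Scope ring_scope.

(** * Gibbs measures and log-Laplace transforms *)

Section bounded_measurable.
Context {R : realType} {d : measure_display} {T : measurableType d}.
Implicit Types (g h : T -> R) (mu : probability T R).

(** This class is stable under sums, products and exponentials, and its members are integrable for
    every probability measure, so real-valued integrals can be handled freely. *)
Definition bounded_mfun h :=
  measurable_fun [set: T] h /\ exists M, forall x, `|h x| <= M.

Lemma bounded_mfun_cst (c : R) : bounded_mfun (fun=> c).
Proof. by split => //; exists `|c|. Qed.

Lemma bounded_mfunD g h :
  bounded_mfun g -> bounded_mfun h -> bounded_mfun (fun x => g x + h x).
Proof.
move=> [mg [a ga]] [mh [b hb]]; split; first exact: measurable_funD.
by exists (a + b) => x; rewrite (le_trans (ler_normD _ _))// lerD.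
Qed.

Lemma bounded_mfunM g h :
  bounded_mfun g -> bounded_mfun h -> bounded_mfun (fun x => g x * h x).
Proof.
move=> [mg [a ga]] [mh [b hb]]; split; first exact: measurable_funM.
by exists (a * b) => x; rewrite normrM ler_pM.
Qed.

Lemma bounded_mfunZ (c : R) h : bounded_mfun h -> bounded_mfun (fun x => c * h x).
Proof. by move=> bh; apply: bounded_mfunM => //; exact: bounded_mfun_cst. Qed.

Lemma bounded_mfunN h : bounded_mfun h -> bounded_mfun (fun x => - h x).
Proof.
move=> bh; have := bounded_mfunZ (-1) bh.
by congr bounded_mfun; apply/funext => x; rewrite mulN1r.
Qed.

Lemma bounded_mfunB g h :
  bounded_mfun g -> bounded_mfun h -> bounded_mfun (fun x => g x - h x).
Proof. by move=> bg bh; apply: bounded_mfunD => //; exact: bounded_mfunN. Qed.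

Lemma bounded_mfun_expR h : bounded_mfun h -> bounded_mfun (fun x => expR (h x)).
Proof.
move=> [mh [M hM]]; split; first exact: measurableT_comp.
exists (expR M) => x; rewrite ger0_norm ?expR_ge0// ler_expR.
exact: le_trans (ler_norm _) (hM x).
Qed.

Lemma bounded_mfun_integrable mu h :
  bounded_mfun h -> mu.-integrable [set: T] (EFin \o h).
Proof.
move=> [mh [M hM]]; apply: measurable_bounded_integrable => //.
  exact: fin_num_fun_lty.
exists M; split; first exact: num_real.
by move=> a /ltW Ma x _; exact: le_trans (hM x) Ma.
Qed.

Lemma Rintegral_EFin mu h : bounded_mfun h ->
  (\int[mu]_x (h x)%:E)%E = (\int[mu]_x h x)%:E.
Proof.
move=> bh; rewrite /Rintegral fineK//; apply: integrable_fin_num => //.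
exact: bounded_mfun_integrable.
Qed.

Lemma le_Rintegral_bounded mu g h : bounded_mfun g -> bounded_mfun h ->
  (forall x, g x <= h x) -> \int[mu]_x g x <= \int[mu]_x h x.
Proof.
by move=> bg bh gh; apply: le_Rintegral => //; exact: bounded_mfun_integrable.
Qed.

Lemma RintegralD_bounded mu g h : bounded_mfun g -> bounded_mfun h ->
  \int[mu]_x (g x + h x) = \int[mu]_x g x + \int[mu]_x h x.
Proof.
by move=> bg bh; rewrite RintegralD//; exact: bounded_mfun_integrable.
Qed.

Lemma RintegralZ_bounded mu (c : R) h : bounded_mfun h ->
  \int[mu]_x (c * h x) = c * \int[mu]_x h x.
Proof. by move=> bh; rewrite RintegralZl//; exact: bounded_mfun_integrable. Qed.

Lemma RintegralB_bounded mu g h : bounded_mfun g -> bounded_mfun h ->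
  \int[mu]_x (g x - h x) = \int[mu]_x g x - \int[mu]_x h x.
Proof.
by move=> bg bh; rewrite RintegralB//; exact: bounded_mfun_integrable.
Qed.

Lemma Rintegral_prob_cst mu (c : R) : \int[mu]_(_ in [set: T]) c = c.
Proof.
rewrite Rintegral_cst// -[RHS]mulr1; congr (_ * _).
by rewrite -[RHS]/(fine 1%E); congr fine; exact: probability_setT.
Qed.

Lemma Rintegral_expR_gt0 mu h : bounded_mfun h -> 0 < \int[mu]_x expR (h x).
Proof.
move=> bh; have [_ [M hM]] := bh.
apply: (@lt_le_trans _ _ (expR (- M))); first exact: expR_gt0.
rewrite -[leLHS](Rintegral_prob_cst mu).
apply: le_Rintegral_bounded; [exact: bounded_mfun_cst| |].
  exact: bounded_mfun_expR.
by move=> x; rewrite ler_expR; have := hM x; rewrite ler_norml => /andP[].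
Qed.

Definition log_laplace mu h : R := ln (\int[mu]_x expR (h x)).

Lemma expR_log_laplace mu h : bounded_mfun h ->
  expR (log_laplace mu h) = \int[mu]_x expR (h x).
Proof. by move=> bh; rewrite lnK// posrE Rintegral_expR_gt0. Qed.

Lemma eq_log_laplace mu g h : g =1 h -> log_laplace mu g = log_laplace mu h.
Proof. by move=> /funext ->. Qed.

Lemma le_log_laplace mu g h : bounded_mfun g -> bounded_mfun h ->
  (forall x, g x <= h x) -> log_laplace mu g <= log_laplace mu h.
Proof.
move=> bg bh gh; rewrite ler_ln ?posrE ?Rintegral_expR_gt0//.
apply: le_Rintegral_bounded; [exact: bounded_mfun_expR..|].
by move=> x; rewrite ler_expR.
Qed.

Lemma log_laplaceDc mu h (c : R) : bounded_mfun h ->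
  log_laplace mu (fun x => h x + c) = log_laplace mu h + c.
Proof.
move=> bh; rewrite -[RHS]expRK expRD expR_log_laplace//; congr ln.
rewrite mulrC -RintegralZ_bounded; last exact: bounded_mfun_expR.
by apply: eq_Rintegral => x _; rewrite expRD mulrC.
Qed.

Lemma gibbsE mu h (A : set T) : bounded_mfun h -> measurable A ->
  gibbs mu h A = (\int[mu]_(x in A) (expR (h x) / \int[mu]_x expR (h x))%:E)%E.
Proof.
move=> bh mA; have [mh _] := bh; have be := bounded_mfun_expR bh.
rewrite /gibbs; case: pselect => // mh'.
have e0 := Rintegral_expR_gt0 mu bh.
rewrite /= /mnormalize /= /exp_measure Rintegral_EFin//.
(* The normalising mass is a positive real number, which excludes the default branch of
   [mnormalize]. *)
rewrite eqe gt_eqF//=.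
transitivity (\int[mu]_(x in A) ((\int[mu]_x expR (h x))^-1%:E * (expR (h x))%:E))%E.
  rewrite ge0_integralZl//.
  - by rewrite muleC.
  - by apply/measurable_EFinP; apply: measurable_funTS; case: be.
  - by rewrite lee_fin invr_ge0 ltW.
by apply: eq_integral => x _; rewrite -EFinM mulrC.
Qed.

Lemma gibbs_dominates mu h : bounded_mfun h -> gibbs mu h `<< mu.
Proof.
move=> bh; apply/null_content_dominatesP => A mA muA0.
rewrite gibbsE// null_set_integral//.
have be := bounded_mfun_expR bh.
apply: measurable_funTS; apply/measurable_EFinP.
by apply: measurable_funM => //; case: be.
Qed.

Lemma Rintegral_gibbs mu h g : bounded_mfun h -> bounded_mfun g ->
  \int[gibbs mu h]_x g x =
  (\int[mu]_x (g x * expR (h x))) / \int[mu]_x expR (h x).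
Proof.
move=> bh bg; have be := bounded_mfun_expR bh.
set Z := \int[mu]_x expR (h x).
have bd : bounded_mfun (fun x => expR (h x) / Z).
  by apply: bounded_mfunM => //; exact: bounded_mfun_cst.
have dom := @gibbs_dominates mu _ bh.
rewrite {1}/Rintegral -(Radon_Nikodym_change_of_variables dom)//; last first.
  exact: bounded_mfun_integrable.
transitivity (fine (\int[mu]_x (g x * (expR (h x) / Z))%:E)%E).
  congr fine; apply: ae_eq_integral => //.
  - apply: emeasurable_funM => //; first by apply/measurable_EFinP; case: bg.
  - by apply/measurable_EFinP; apply: measurable_funM; [case: bg|case: bd].
  under [X in ae_eq _ _ _ X]eq_fun do rewrite EFinM.
  (* The Radon-Nikodym derivative is known through its integrals over measurable sets; by [gibbsE]
     the explicit density has the same ones. *)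
  apply: ae_eqe_mul2l; apply: integral_ae_eq => //=.
  - exact: Radon_Nikodym_integrable.
  - by apply/measurable_EFinP; case: bd.
  - by move=> A _ mA; rewrite -Radon_Nikodym_integral//= gibbsE.
rewrite -[LHS]/(\int[mu]_x (g x * (expR (h x) / Z))).
rewrite [RHS]mulrC -RintegralZ_bounded; last exact: bounded_mfunM.
by apply: eq_Rintegral => x _; rewrite mulrA [RHS]mulrC.
Qed.

Lemma Rintegral_gibbs_expR mu h g : bounded_mfun h -> bounded_mfun g ->
  ln (\int[gibbs mu h]_x expR (g x)) =
  log_laplace mu (fun x => h x + g x) - log_laplace mu h.
Proof.
move=> bh bg; rewrite Rintegral_gibbs//; last exact: bounded_mfun_expR.
rewrite -ln_div ?posrE ?Rintegral_expR_gt0//; last exact: bounded_mfunD.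
by congr (ln (_ / _)); apply: eq_Rintegral => x _; rewrite expRD mulrC.
Qed.

(** Jensen's inequality: the tangent [expR m * (1 + (g x - m))] of the exponential at the mean [m]
    lies below [expR (g x)] and integrates to [expR m]. *)
Lemma Rintegral_le_log_laplace mu g : bounded_mfun g ->
  \int[mu]_x g x <= log_laplace mu g.
Proof.
move=> bg; have [m mE] : exists m, m = \int[mu]_x g x by eexists.
have bm := bounded_mfun_cst m.
rewrite -mE -[leLHS]expRK ler_ln ?posrE ?expR_gt0 ?Rintegral_expR_gt0//.
apply: (@le_trans _ _ (\int[mu]_x (expR m * (1 + (g x - m))))).
  rewrite RintegralZ_bounded; last first.
    by apply: bounded_mfunD; [exact: bounded_mfun_cst|exact: bounded_mfunB].
  rewrite RintegralD_bounded; [|exact: bounded_mfun_cst|exact: bounded_mfunB].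
  by rewrite RintegralB_bounded// !Rintegral_prob_cst -mE subrr addr0 mulr1.
apply: le_Rintegral_bounded.
- apply: bounded_mfunZ; apply: bounded_mfunD; first exact: bounded_mfun_cst.
  exact: bounded_mfunB.
- exact: bounded_mfun_expR.
- move=> x; rewrite -[in leRHS](subrKC m (g x)) expRD.
  by rewrite ler_pM2l ?expR_gt0// expR_ge1Dx.
Qed.

(** Applied with [g] a positive or negative multiple of a risk, this bounds its Gibbs mean from
    above or from below. *)
Lemma gibbs_le_log_laplace mu h g : bounded_mfun h -> bounded_mfun g ->
  \int[gibbs mu h]_x g x <=
  log_laplace mu (fun x => h x + g x) - log_laplace mu h.
Proof.
move=> bh bg; rewrite -Rintegral_gibbs_expR//.
exact: Rintegral_le_log_laplace.
Qed.

(** Jensen is used twice under the Gibbs measure of the mixture [k]; with weights [1 - q] and [q]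
    the means of [h - k] and [g - k] cancel. *)
Lemma log_laplace_convex mu h g (q : R) : bounded_mfun h -> bounded_mfun g ->
  0 <= q <= 1 ->
  log_laplace mu (fun x => (1 - q) * h x + q * g x) <=
  (1 - q) * log_laplace mu h + q * log_laplace mu g.
Proof.
move=> bh bg /andP[q0 q1]; set k := fun x => _.
have bk : bounded_mfun k by apply: bounded_mfunD; exact: bounded_mfunZ.
have bkh : bounded_mfun (fun x => h x - k x) by exact: bounded_mfunB.
have bkg : bounded_mfun (fun x => g x - k x) by exact: bounded_mfunB.
have := gibbs_le_log_laplace mu bk bkh; have := gibbs_le_log_laplace mu bk bkg.
rewrite (@eq_log_laplace _ (fun x => k x + (g x - k x)) g); last first.
  by move=> x; rewrite subrKC.
rewrite (@eq_log_laplace _ (fun x => k x + (h x - k x)) h); last first.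
  by move=> x; rewrite subrKC.
move=> Hg Hh.
have : (1 - q) * \int[gibbs mu k]_x (h x - k x)
       + q * \int[gibbs mu k]_x (g x - k x) = 0.
  rewrite -!RintegralZ_bounded// -RintegralD_bounded; [|exact: bounded_mfunZ..].
  rewrite -[RHS](Rintegral_prob_cst (gibbs mu k)).
  by apply: eq_Rintegral => x _; rewrite /k; ring.
move: {Hg}(ler_wpM2l q0 Hg).
have {Hh} : (1 - q) * \int[gibbs mu k]_x (h x - k x) <=
    (1 - q) * (log_laplace mu h - log_laplace mu k).
  by rewrite ler_wpM2l ?subr_ge0.
move: (log_laplace mu h) (log_laplace mu g) (log_laplace mu k).
move: (Rintegral _ _ _) (Rintegral _ _ _) => I J a b c.
clear; lra.
Qed.

(** Comparing integrals over measurable sets shows that the derivative of [mu] with respect to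
    itself is 1 almost everywhere, so its logarithm integrates to 0. *)
Lemma kullback_refl mu : kullback mu mu = 0%E.
Proof.
have mumu : mu `<< mu by [].
rewrite /kullback asboolT//.
set f := Radon_Nikodym _ _.
have mf : measurable_fun [set: T] f.
  by apply: measurable_int; exact: Radon_Nikodym_integrable.
have f1 : ae_eq mu [set: T] f (cst 1%E).
  apply: integral_ae_eq => //; first exact: Radon_Nikodym_integrable.
  by move=> A _ mA; rewrite -Radon_Nikodym_integral//= integral_cst// mul1e.
rewrite (@ae_eq_integral _ _ _ _ _ (cst 0%E))//; first by rewrite integral0.
  have fE x : f x = (fine (f x))%:E by rewrite fineK// Radon_Nikodym_fin_num.
  under eq_fun do rewrite fE.
  have mff : measurable_fun [set: T] (fine \o f) by exact: measurableT_comp.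
  apply: measurable_fun_ifT => //; first exact: measurable_fun_ler.
  by apply/measurable_EFinP; exact: measurableT_comp.
by move: f1; apply: filterS => x /= fx _; rewrite fx// lne1.
Qed.

End bounded_measurable.

(** * Product measures *)

Section bounded_measurable_big.
Context {R : realType} {d : measure_display} {T : measurableType d}.

Lemma bounded_mfun_sum (I : Type) (s : seq I) (F : I -> T -> R) :
  (forall i, bounded_mfun (F i)) -> bounded_mfun (fun x => \sum_(i <- s) F i x).
Proof.
move=> bF; elim: s => [|i s IHs].
  by under eq_fun do rewrite big_nil; exact: bounded_mfun_cst.
by under eq_fun do rewrite big_cons; exact: bounded_mfunD.
Qed.

Lemma bounded_mfun_prod (I : Type) (s : seq I) (F : I -> T -> R) :
  (forall i, bounded_mfun (F i)) -> bounded_mfun (fun x => \prod_(i <- s) F i x).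
Proof.
move=> bF; elim: s => [|i s IHs].
  by under eq_fun do rewrite big_nil; exact: bounded_mfun_cst.
by under eq_fun do rewrite big_cons; exact: bounded_mfunM.
Qed.

Lemma Rintegral_sum_bounded (mu : probability T R) (I : Type) (s : seq I)
    (F : I -> T -> R) : (forall i, bounded_mfun (F i)) ->
  \int[mu]_x (\sum_(i <- s) F i x) = \sum_(i <- s) \int[mu]_x F i x.
Proof.
move=> bF; elim: s => [|i s IHs].
  rewrite big_nil -[RHS](Rintegral_prob_cst mu).
  by apply: eq_Rintegral => x _; rewrite big_nil.
rewrite big_cons -IHs -RintegralD_bounded//; last exact: bounded_mfun_sum.
by apply: eq_Rintegral => x _; rewrite big_cons.
Qed.

Lemma bounded_mfun_indic (A : set T) :
  measurable A -> bounded_mfun (\1_A : T -> R).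
Proof.
move=> mA; split; first exact: measurable_indic.
by exists 1 => x; rewrite indicE ger0_norm ?lern1 ?ler0n// leq_b1.
Qed.

Lemma Rintegral_indic_bounded (mu : probability T R) (A : set T) :
  measurable A -> \int[mu]_x \1_A x = fine (mu A).
Proof. by move=> mA; rewrite /Rintegral integral_indic// setIT. Qed.

End bounded_measurable_big.

Section product_expectation.
Context {R : realType} {d : measure_display} {T : measurableType d} {N : nat}.
Variables (p : 'I_N -> probability T R) (P : probability (N.-tuple T) R).
Hypothesis pP : is_product_measure p P.

Lemma product_measure_marginal (i : 'I_N) (A : set T) : measurable A ->
  P [set w | A (tnth w i)] = p i A.
Proof.
move=> mA; pose B j := if j == i then A else [set: T].
have mB j : measurable (B j) by rewrite /B; case: ifP.
rewrite [X in P X](_ : _ = [set w | forall j, B j (tnth w j)]); last first.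
  apply/seteqP; split => w /= wA; last by have := wA i; rewrite /B eqxx.
  by move=> j; rewrite /B; case: eqP => // ->.
rewrite pP// (bigD1 i)//= /B eqxx big1 ?mule1// => j /negbTE ->.
exact: probability_setT.
Qed.

Lemma measurable_tnth_preimage (i : 'I_N) (A : set T) : measurable A ->
  measurable [set w : N.-tuple T | A (tnth w i)].
Proof.
by move=> mA; rewrite -[X in measurable X]setTI; exact: measurable_tnth.
Qed.

(** Independence for simple functions of the coordinates: expanding the product over all choice
    functions [g] leaves probabilities of rectangles, which [is_product_measure] evaluates. *)
Lemma product_expectation (K : finType) (c : K -> R) (A : K -> set T) :
  (forall k, measurable (A k)) ->
  \int[P]_w \prod_(i < N) \sum_k c k * \1_(A k) (tnth w i) =
  \prod_(i < N) \int[P]_w \sum_k c k * \1_(A k) (tnth w i).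
Proof.
move=> mA.
have bA i k : bounded_mfun (fun w : N.-tuple T => \1_(A k) (tnth w i) : R).
  exact: (bounded_mfun_indic (measurable_tnth_preimage i (mA k))).
have mAall (g : {ffun 'I_N -> K}) :
    measurable [set w : N.-tuple T | forall i, A (g i) (tnth w i)].
  rewrite [X in measurable X](_ : _ =
    \bigcap_(i in [set: 'I_N]) [set w | A (g i) (tnth w i)]); last first.
    by apply/seteqP; split => w /= wA i; [move=> _|]; exact: wA.
  by apply: fin_bigcap_measurable => // i _; exact: measurable_tnth_preimage.
transitivity (\int[P]_w \sum_(g : {ffun 'I_N -> K})
    (\prod_i c (g i)) * \1_[set w | forall i, A (g i) (tnth w i)] w).
  apply: eq_Rintegral => w _; rewrite bigA_distr_bigA /=.
  apply: eq_bigr => g _; rewrite big_split /=; congr (_ * _).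
  rewrite indicE; case: (boolP (w \in _)) => [|wA].
    by rewrite inE /= => wA; rewrite big1// => i _; rewrite indicE mem_set.
  have [i nA] : exists i, ~ A (g i) (tnth w i).
    by apply/existsNP; move: wA; rewrite notin_setE.
  by rewrite (bigD1 i)//= indicE memNset// mul0r.
rewrite Rintegral_sum_bounded; last first.
  by move=> g; apply: bounded_mfunZ; exact: bounded_mfun_indic.
under [RHS]eq_bigr => i _.
  rewrite Rintegral_sum_bounded; last by move=> k; exact: bounded_mfunZ.
  over.
rewrite bigA_distr_bigA /=; apply: eq_bigr => g _.
rewrite RintegralZ_bounded; last exact: bounded_mfun_indic.
rewrite Rintegral_indic_bounded//.
under [RHS]eq_bigr => i _.
  rewrite RintegralZ_bounded//.
  rewrite (@Rintegral_indic_bounded _ _ _ P [set w | A (g i) (tnth w i)]); last first.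
    exact: measurable_tnth_preimage.
  rewrite product_measure_marginal//; over.
rewrite big_split /=; congr (_ * _).
have := congr1 fine (pP (fun i => mA (g i))).
rewrite (eq_bigr (fun i => (fine (p i (A (g i))))%:E)) ?prodEFin// => i _.
by rewrite fineK// fin_num_measure.
Qed.

End product_expectation.

(** * Fubini's theorem for bounded nonnegative functions *)

Section product_integral.
Context {R : realType} {d1 d2 : measure_display}.
Context {T1 : measurableType d1} {T2 : measurableType d2}.
Variables (mu : probability T1 R) (nu : probability T2 R) (G : T1 * T2 -> R).
Hypotheses (bG : bounded_mfun G) (G0 : forall z, 0 <= G z).

Lemma bounded_mfun_pair1 (x : T1) : bounded_mfun (fun y => G (x, y)).
Proof.
have [mG [M GM]] := bG; split; last by exists M.
exact: (measurableT_comp mG (measurable_pair1 x)).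
Qed.

Lemma bounded_mfun_pair2 (y : T2) : bounded_mfun (fun x => G (x, y)).
Proof.
have [mG [M GM]] := bG; split; last by exists M.
exact: (measurableT_comp mG (measurable_pair2 y)).
Qed.

Let mEG : measurable_fun [set: T1 * T2] (EFin \o G).
Proof. by apply/measurable_EFinP; case: bG. Qed.

Let EG0 z : (0 <= (EFin \o G) z)%E. Proof. by rewrite /= lee_fin. Qed.

Lemma bounded_mfun_Rintegral1 : bounded_mfun (fun x => \int[nu]_y G (x, y)).
Proof.
split.
  apply/measurable_EFinP.
  have := @measurable_fun_fubini_tonelli_F _ _ _ _ _ nu _ mEG EG0.
  congr (measurable_fun _ _); apply/funext => x /=.
  by rewrite /fubini_F Rintegral_EFin//; exact: bounded_mfun_pair1.
have [_ [M GM]] := bG; exists M => x.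
rewrite ger0_norm; last by apply: Rintegral_ge0 => y _.
rewrite -[leRHS](Rintegral_prob_cst nu); apply: le_Rintegral_bounded.
- exact: bounded_mfun_pair1.
- exact: bounded_mfun_cst.
- by move=> y; rewrite (le_trans (ler_norm _)).
Qed.

Lemma bounded_mfun_Rintegral2 : bounded_mfun (fun y => \int[mu]_x G (x, y)).
Proof.
split.
  apply/measurable_EFinP.
  have := @measurable_fun_fubini_tonelli_G _ _ _ _ _ mu _ mEG EG0.
  congr (measurable_fun _ _); apply/funext => y /=.
  by rewrite /fubini_G Rintegral_EFin//; exact: bounded_mfun_pair2.
have [_ [M GM]] := bG; exists M => y.
rewrite ger0_norm; last by apply: Rintegral_ge0 => x _.
rewrite -[leRHS](Rintegral_prob_cst mu); apply: le_Rintegral_bounded.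
- exact: bounded_mfun_pair2.
- exact: bounded_mfun_cst.
- by move=> x; rewrite (le_trans (ler_norm _)).
Qed.

Lemma Rintegral_swap :
  \int[mu]_x (\int[nu]_y G (x, y)) = \int[nu]_y (\int[mu]_x G (x, y)).
Proof.
have := @fubini_tonelli _ _ _ _ _ mu nu _ mEG EG0.
rewrite /= => E; congr fine; transitivity (\int[mu]_x \int[nu]_y (G (x, y))%:E)%E.
  by apply: eq_integral => x _; rewrite Rintegral_EFin//; exact: bounded_mfun_pair1.
rewrite E; apply: eq_integral => y _.
by rewrite Rintegral_EFin//; exact: bounded_mfun_pair2.
Qed.

End product_integral.

(** Markov's inequality is applied once, to the sum of the [V i], whose expectation is at most
    [#|I|]; each nonnegative [V i] lies below this sum. *)
Lemma simultaneous_markov {R : realType} {d : measure_display}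
    {T : measurableType d} (P : probability T R) (I : finType)
    (V : I -> T -> R) (eps : R) :
  (forall i, bounded_mfun (V i)) -> (forall i w, 0 <= V i w) ->
  (forall i, \int[P]_w V i w <= 1) -> (0 < #|I|)%N -> 0 < eps ->
  exists2 E : set T, measurable E /\ ((1 - eps)%:E <= P E)%E &
    forall w, E w -> forall i, V i w <= #|I|%:R / eps.
Proof.
move=> bV V0 V1 I0 eps0; pose S w := \sum_i V i w.
have bS : bounded_mfun S by exact: bounded_mfun_sum.
have c0 : 0 < #|I|%:R / eps :> R by rewrite divr_gt0 ?ltr0n.
set c := #|I|%:R / eps in c0 *.
have mE : measurable [set w | S w <= c].
  rewrite -[X in measurable X]setTI.
  have := measurable_fun_ler bS.1 (@measurable_cst _ _ T R [set: T] c).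
  by move=> /(_ measurableT [set true]); apply.
exists [set w | S w <= c]; last first.
  move=> w /= Sc i; apply: le_trans Sc.
  by rewrite /S (bigD1 i)//= lerDl sumr_ge0.
split=> //; set E := [set w | S w <= c] in mE *.
have mEc : measurable (~` E) by exact: measurableC.
have : c * fine (P (~` E)) <= #|I|%:R.
  rewrite -Rintegral_indic_bounded// -RintegralZ_bounded; last first.
    exact: bounded_mfun_indic.
  apply: (@le_trans _ _ (\int[P]_w S w)).
    apply: le_Rintegral_bounded => //.
      by apply: bounded_mfunZ; exact: bounded_mfun_indic.
    move=> w; rewrite indicE; case: (boolP (w \in _)); last first.
      by rewrite mulr0 sumr_ge0.
    by rewrite inE /E /= mulr1 => /negP; rewrite -ltNge => /ltW.
  rewrite /S Rintegral_sum_bounded// -[#|I|]sum1_card natr_sum.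
  exact: ler_sum.
rewrite probability_setC//.
rewrite -[P E]fineK ?fin_num_measure//= lee_fin.
rewrite /c -mulrA ger_pMr ?ltr0n// ler_pdivrMl// mulr1.
lra.
Qed.

(** * Second-order bounds for the exponential *)

Section exponential_bounds.
Context {R : realType}.
Implicit Types (a b s v y : R).

(** On the one hand [expR y * (1 - y) <= 1]; on the other, [(1 + y + 2 * y ^+ 2) * (1 - y)] equals
    [1 + y ^+ 2 * (1 - 2 * y)], which is at least 1. *)
Lemma expR_le_quadratic y : `|y| <= 1 / 2 -> expR y <= 1 + y + 2 * y ^+ 2.
Proof.
rewrite ler_norml => /andP[y1 y2].
have ymy : expR y * (1 - y) <= 1.
  apply: (@le_trans _ _ (expR y * expR (- y))); last by rewrite expRxMexpNx_1.
  by rewrite ler_pM2l ?expR_gt0// expR_ge1Dx.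
have : 1 <= (1 + y + 2 * y ^+ 2) * (1 - y).
  have : 0 <= y ^+ 2 * (1 - 2 * y) by rewrite mulr_ge0 ?sqr_ge0//; lra.
  by clear; lra.
move=> /(le_trans ymy); rewrite ler_pM2r//; lra.
Qed.

(** The square of [v] equals its absolute value, so the second-order term can be charged to the
    latter. *)
Lemma expR_ternary a b s v :
  v = 0 \/ `|v| = 1 -> `|a| <= s -> 0 <= b <= 2 * s ^+ 2 -> s <= 1 / 4 ->
  expR (a * v + b * `|v|) <= 1 + a * v + 9 * s ^+ 2 * `|v|.
Proof.
move=> [->|v1] as_ /andP[b0 bs] s4; first by rewrite normr0 !mulr0 !addr0 expR0.
have s0 : 0 <= s by rewrite (le_trans _ as_).
rewrite v1 !mulr1; set y := a * v + b.
(* In absolute value the exponent is at most [s + 2 * s ^+ 2 <= 3 / 2 * s], so [b + 2 * y ^+ 2] is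
   at most [13 / 2 * s ^+ 2], below the claimed [9 * s ^+ 2]. *)
have ys : `|y| <= 3 / 2 * s.
  rewrite (le_trans (ler_normD _ _))// normrM v1 mulr1 (ger0_norm b0).
  have : s ^+ 2 <= 1 / 4 * s by rewrite expr2 ler_wpM2r.
  by move: as_ bs; clear; lra.
have y2 : y ^+ 2 <= (3 / 2 * s) ^+ 2.
  by rewrite -(real_normK (num_real y)) lerXn2r// nnegrE// mulr_ge0//; lra.
apply: le_trans (expR_le_quadratic _) _; first by move: ys s4; clear; lra.
move: y2; rewrite /y; move: bs (sqr_ge0 s); clear.
move: (a * v) => u.
rewrite exprMn; lra.
Qed.

End exponential_bounds.

(** * Exponential moments of the empirical process *)

Lemma measurable_eq_finite {R : realType} {dY dZ : measure_display}
    {Y : measurableType dY} {Z : measurableType dZ} (g1 g2 : Z -> Y) :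
  finite_set [set: Y] -> (forall C : set Y, measurable C) ->
  measurable_fun [set: Z] g1 -> measurable_fun [set: Z] g2 ->
  measurable [set z | g1 z = g2 z].
Proof.
move=> Yfin mY mg1 mg2.
rewrite [X in measurable X](_ : _ =
    \bigcup_(y in [set: Y]) (g1 @^-1` [set y] `&` g2 @^-1` [set y])).
  apply: fin_bigcup_measurable => // y _; apply: measurableI.
    by rewrite -[X in measurable X]setTI; exact: mg1.
  by rewrite -[X in measurable X]setTI; exact: mg2.
apply/seteqP; split => [z /= e|z [y _ [/= -> ->]]//].
by exists (g2 z).
Qed.

Section empirical_process.
Context {R : realType} {dX dY dT : measure_display}.
Context {X : measurableType dX} {Y : measurableType dY}.
Context {Theta : measurableType dT} {N : nat}.
Variable f : Theta -> X -> Y.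
Hypothesis Yfin : finite_set [set: Y].
Hypothesis mY : forall C : set Y, measurable C.
Hypothesis mf : measurable_fun [set: Theta * X] (fun z => f z.1 z.2).
Implicit Types (w : N.-tuple (X * Y)%type) (th : Theta).

Local Notation err := (@err R _ _ _ X Y Theta N f).
Local Notation emp_risk := (@emp_risk R _ _ _ X Y Theta N f).
Local Notation emp_margin := (@emp_margin R _ _ _ X Y Theta N f).

Lemma measurable_neq_label {dZ : measure_display} {Z : measurableType dZ}
    (th : Z -> Theta) (xy : Z -> X * Y) :
  measurable_fun [set: Z] th -> measurable_fun [set: Z] xy ->
  measurable [set z | f (th z) (xy z).1 != (xy z).2].
Proof.
move=> mth mxy.
rewrite (_ : [set z | _] = ~` [set z | f (th z) (xy z).1 = (xy z).2]); last first.
  by apply/seteqP; split => z /eqP.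
apply: measurableC; apply: measurable_eq_finite => //.
  apply: (measurableT_comp mf (g := fun z => (th z, (xy z).1))).
  apply/measurable_fun_pairP; split => //.
  exact: (measurableT_comp measurable_fst mxy).
exact: (measurableT_comp measurable_snd mxy).
Qed.

Lemma err_indic w th i :
  err w th i = \1_[set w | f th (tnth w i).1 != (tnth w i).2] w.
Proof.
rewrite /Defs.err indicE; congr (nat_of_bool _)%:R.
by apply/idP/idP; rewrite inE.
Qed.

Lemma bounded_mfun_err {dZ : measure_display} {Z : measurableType dZ}
    (th : Z -> Theta) (w : Z -> N.-tuple (X * Y)%type) (i : 'I_N) :
  measurable_fun [set: Z] th -> measurable_fun [set: Z] w ->
  bounded_mfun (fun z => err (w z) (th z) i).
Proof.
move=> mth mw.
rewrite (_ : (fun z => _) =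
    \1_[set z | f (th z) (tnth (w z) i).1 != (tnth (w z) i).2]).
  apply/bounded_mfun_indic/(measurable_neq_label (xy := fun z => tnth (w z) i)) => //.
  exact: (measurableT_comp (measurable_tnth i) mw).
apply/funext => z; rewrite /Defs.err indicE; congr (nat_of_bool _)%:R.
by apply/idP/idP; rewrite inE.
Qed.

Lemma bounded_mfun_norm {dZ : measure_display} {Z : measurableType dZ}
  (h : Z -> R) : bounded_mfun h -> bounded_mfun (fun z => `|h z|).
Proof.
move=> [mh [M hM]]; split; first exact: measurableT_comp.
by exists M => z; rewrite normr_id.
Qed.

Lemma bounded_mfun_emp_risk {dZ : measure_display} {Z : measurableType dZ}
    (th : Z -> Theta) (w : Z -> N.-tuple (X * Y)%type) :
  measurable_fun [set: Z] th -> measurable_fun [set: Z] w ->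
  bounded_mfun (fun z => emp_risk (w z) (th z)).
Proof.
move=> mth mw; apply: bounded_mfunZ; apply: bounded_mfun_sum => i.
exact: bounded_mfun_err.
Qed.

Lemma bounded_mfun_emp_margin {dZ : measure_display} {Z : measurableType dZ}
    (th th' : Z -> Theta) (w : Z -> N.-tuple (X * Y)%type) :
  measurable_fun [set: Z] th -> measurable_fun [set: Z] th' ->
  measurable_fun [set: Z] w ->
  bounded_mfun (fun z => emp_margin (w z) (th z) (th' z)).
Proof.
move=> mth mth' mw; apply: bounded_mfunZ; apply: bounded_mfun_sum => i.
apply: bounded_mfun_norm.
by apply: bounded_mfunB; exact: bounded_mfun_err.
Qed.

Lemma err_bool w th i : err w th i = 0 \/ err w th i = 1.
Proof. by rewrite /Defs.err; case: eqP; [left|right]. Qed.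

Lemma errB_ternary w th th' i :
  err w th i - err w th' i = 0 \/ `|err w th i - err w th' i| = 1.
Proof.
case: (err_bool w th i) => ->; case: (err_bool w th' i) => ->.
- by left; rewrite subrr.
- by right; rewrite sub0r normrN normr1.
- by right; rewrite subr0 normr1.
- by left; rewrite subrr.
Qed.

Lemma emp_margin_le w th th' th'' :
  emp_margin w th th' <= emp_margin w th th'' + emp_margin w th' th''.
Proof.
rewrite /Defs.emp_margin -mulrDr ler_wpM2l ?invr_ge0// -big_split ler_sum// => i _.
by rewrite [X in _ <= _ + X]distrC; exact: ler_distD.
Qed.

Lemma emp_margin_ge0 w th th' : 0 <= emp_margin w th th'.
Proof. by rewrite mulr_ge0 ?invr_ge0// sumr_ge0. Qed.

Lemma emp_margin_le1 w th th' : emp_margin w th th' <= 1.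
Proof.
(* When [N] is 0, the inverse of 0 is 0 by convention and so is the margin. *)
have [N0|N0] := posnP N.
  rewrite /Defs.emp_margin (_ : N%:R^-1 = 0) ?mul0r//.
  by move: (N0) => ->; rewrite invr0.
rewrite /Defs.emp_margin mulrC ler_pdivrMr ?ltr0n// mul1r.
rewrite [leRHS](_ : _ = \sum_(i < N) 1); last by rewrite sumr_const card_ord.
apply: ler_sum => i _.
by case: (errB_ternary w th th' i) => ->; rewrite ?normr0.
Qed.

Variables (p : 'I_N -> probability (X * Y)%type R).
Variables (P : probability (N.-tuple (X * Y)%type) R) (tht : Theta).
Hypothesis pP : is_product_measure p P.

Lemma bounded_mfun_errw th i : bounded_mfun (fun w => err w th i).
Proof. by apply: (@bounded_mfun_err _ _ (fun=> th) id). Qed.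

Lemma risk_Rintegral th : risk f P th = \int[P]_w emp_risk w th.
Proof.
rewrite /risk /Defs.emp_risk RintegralZ_bounded; last first.
  by apply: bounded_mfun_sum => i; exact: bounded_mfun_errw.
congr (_ * _); rewrite Rintegral_sum_bounded; last first.
  by move=> i; exact: bounded_mfun_errw.
apply: eq_bigr => i _.
rewrite -Rintegral_indic_bounded; last first.
  apply: (@measurable_neq_label _ _ (fun=> th) (fun w => tnth w i)) => //.
  exact: measurable_tnth.
by apply: eq_Rintegral => w _; rewrite err_indic.
Qed.

Lemma margin_RintegralE th :
  margin f P th tht = N%:R^-1 *
    \sum_(i < N) \int[P]_w `|err w th i - err w tht i|.
Proof.
have bD i : bounded_mfun (fun w => `|err w th i - err w tht i|).
  by apply: bounded_mfun_norm; apply: bounded_mfunB; exact: bounded_mfun_errw.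
rewrite /margin /Defs.emp_margin RintegralZ_bounded; last exact: bounded_mfun_sum.
by rewrite Rintegral_sum_bounded.
Qed.

Lemma riskB_RintegralE th :
  risk f P th - risk f P tht = N%:R^-1 *
    \sum_(i < N) \int[P]_w (err w th i - err w tht i).
Proof.
have be th' i := bounded_mfun_errw th' i.
rewrite !risk_Rintegral /Defs.emp_risk.
rewrite !RintegralZ_bounded; [|exact: bounded_mfun_sum..].
rewrite -mulrBr -RintegralB_bounded; [|exact: bounded_mfun_sum..].
rewrite -Rintegral_sum_bounded; last by move=> i; exact: bounded_mfunB.
by congr (_ * _); apply: eq_Rintegral => w _; rewrite sumrB.
Qed.

(** The exponent splits over the coordinates. Each factor is dominated by [G], affine in the loss
    difference [D] and its absolute value ([expR_ternary] at scale [sigma]); independence gives the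
    product of the means, and [1 + u <= expR u] returns to an exponential. *)
Lemma exponential_moment (t s sigma : R) th : (0 < N)%N ->
  `|t| <= sigma * N%:R -> 0 <= s <= 2 * (sigma ^+ 2 * N%:R) -> sigma <= 1 / 4 ->
  \int[P]_w expR (t * (emp_risk w th - emp_risk w tht) + s * emp_margin w th tht)
  <= expR (t * (risk f P th - risk f P tht) +
           9 * (sigma ^+ 2 * N%:R) * margin f P th tht).
Proof.
move=> N0 ts /andP[s0 ss] sig4.
have N0' : 0 < N%:R :> R by rewrite ltr0n.
have NN : N%:R * N%:R^-1 = 1 :> R by rewrite divff// gt_eqF.
pose D i w := err w th i - err w tht i.
pose a := t / N%:R; pose b := s / N%:R; pose h := 9 * sigma ^+ 2.
have bD i : bounded_mfun (D i) by apply: bounded_mfunB; exact: bounded_mfun_errw.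
have bnD i : bounded_mfun (fun w => `|D i w|) by exact: bounded_mfun_norm.
pose G i w := 1 + a * D i w + h * `|D i w|.
have bG i : bounded_mfun (G i).
  apply: bounded_mfunD; last exact: bounded_mfunZ.
  by apply: bounded_mfunD; [exact: bounded_mfun_cst|exact: bounded_mfunZ].
have expG i w : expR (a * D i w + b * `|D i w|) <= G i w.
  apply: expR_ternary => //; first exact: errB_ternary.
    by rewrite normrM [X in _ * X]ger0_norm ?invr_ge0 ?ler0n// ler_pdivrMr.
  by rewrite divr_ge0// ler_pdivrMr// -mulrA.
have expE w : expR (t * (emp_risk w th - emp_risk w tht) +
    s * emp_margin w th tht) = \prod_(i < N) expR (a * D i w + b * `|D i w|).
  rewrite -expR_sum big_split /= -!mulr_sumr /D sumrB /Defs.emp_risk /Defs.emp_margin.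
  by congr expR; rewrite /a /b; ring.
under eq_Rintegral do rewrite expE.
apply: (@le_trans _ _ (\int[P]_w \prod_(i < N) G i w)).
  apply: le_Rintegral_bounded.
  - apply: bounded_mfun_prod => i; apply: bounded_mfun_expR.
    by apply: bounded_mfunD; exact: bounded_mfunZ.
  - exact: bounded_mfun_prod.
  - by move=> w; apply: ler_prod => i _; rewrite expR_ge0 expG.
pose U : set (X * Y) := [set xy | f th xy.1 != xy.2].
pose V : set (X * Y) := [set xy | f tht xy.1 != xy.2].
(* The loss difference is 1 on [U] minus [V], -1 on [V] minus [U] and 0 elsewhere, so [G] combines
   three indicators and [product_expectation] applies. *)
pose A (k : 'I_3) := tnth [tuple [set: X * Y]; U `\` V; V `\` U] k.
pose c (k : 'I_3) := tnth [tuple 1; a + h; h - a] k.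
have mA k : measurable (A k).
  have mU : measurable U by apply: (@measurable_neq_label _ _ (fun=> th) id).
  have mV : measurable V by apply: (@measurable_neq_label _ _ (fun=> tht) id).
  rewrite /A; case: k => -[|[|[|//]]] ?; first exact: measurableT.
    exact: measurableD.
  exact: measurableD.
have GE i w : G i w = \sum_k c k * \1_(A k) (tnth w i).
  rewrite !big_ord_recl big_ord0 /c /A /= !(tnth_nth 0) !(tnth_nth set0) /=.
  rewrite /G /D /Defs.err !indicE in_setT !in_setD /=.
  rewrite (_ : (tnth w i \in U) = (f th (tnth w i).1 != (tnth w i).2)); last first.
    by apply/idP/idP; rewrite inE.
  rewrite (_ : (tnth w i \in V) = (f tht (tnth w i).1 != (tnth w i).2)); last first.
    by apply/idP/idP; rewrite inE.
  case: (f th _ != _); case: (f tht _ != _) => /=.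
  - by rewrite subrr normr0; ring.
  - by rewrite subr0 normr1; ring.
  - by rewrite sub0r normrN normr1; ring.
  - by rewrite subrr normr0; ring.
have -> : \int[P]_w (\prod_(i < N) G i w) = \prod_(i < N) \int[P]_w G i w.
  under eq_Rintegral do under eq_bigr do rewrite GE.
  rewrite (product_expectation pP)//; apply: eq_bigr => i _.
  by apply: eq_Rintegral => w _; rewrite GE.
apply: (@le_trans _ _ (\prod_(i < N)
    expR (a * \int[P]_w D i w + h * \int[P]_w `|D i w|))).
  apply: ler_prod => i _; apply/andP; split.
    by apply: Rintegral_ge0 => w _; rewrite (le_trans _ (expG i w))// expR_ge0.
  rewrite /G RintegralD_bounded; [|apply: bounded_mfunD|]; last 3 first.
  - exact: bounded_mfun_cst.
  - exact: bounded_mfunZ.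
  - exact: bounded_mfunZ.
  rewrite RintegralD_bounded; [|exact: bounded_mfun_cst|exact: bounded_mfunZ].
  by rewrite Rintegral_prob_cst !RintegralZ_bounded// -addrA expR_ge1Dx.
rewrite -expR_sum ler_expR big_split /= -!mulr_sumr.
rewrite riskB_RintegralE margin_RintegralE /a /h /D.
have NNV (x y : R) : x * N%:R * (N%:R^-1 * y) = x * y.
  by rewrite -mulrA (mulrA N%:R) NN mul1r.
by rewrite (mulrA 9 (sigma ^+ 2)) NNV (mulrA t).
Qed.

End empirical_process.

(** * Simultaneous control of log-Laplace transforms on one event *)

Section deviation_event.
Context {R : realType} {dX dY dT : measure_display}.
Context {X : measurableType dX} {Y : measurableType dY}.
Context {Theta : measurableType dT} {N : nat}.
Variable f : Theta -> X -> Y.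
Hypothesis Yfin : finite_set [set: Y].
Hypothesis mY : forall C : set Y, measurable C.
Hypothesis mf : measurable_fun [set: Theta * X] (fun z => f z.1 z.2).
Variables (p : 'I_N -> probability (X * Y)%type R).
Variables (P : probability (N.-tuple (X * Y)%type) R) (tht : Theta).
Hypothesis pP : is_product_measure p P.
Variable pi : probability Theta R.

Local Notation r' w th := (emp_risk f w th - emp_risk f w tht).
Local Notation m' w th := (emp_margin f w th tht).
Local Notation R' th := (risk f P th - risk f P tht).
Local Notation M' th := (margin f P th tht).

Lemma bounded_mfun_emp_riskB (w : N.-tuple (X * Y)%type) :
  bounded_mfun (fun th => r' w th : R).
Proof.
by apply: bounded_mfunB; apply: (bounded_mfun_emp_risk (N := N) Yfin mY mf).
Qed.

Lemma bounded_mfun_emp_margin1 (w : N.-tuple (X * Y)%type) :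
  bounded_mfun (fun th => m' w th : R).
Proof. by apply: (bounded_mfun_emp_margin (N := N) Yfin mY mf). Qed.

Lemma bounded_mfun_risk : bounded_mfun (risk f P).
Proof.
rewrite (_ : risk f P = fun th => \int[P]_w emp_risk f w th); last first.
  by apply/funext => th; rewrite (risk_Rintegral Yfin mY mf).
apply: (bounded_mfun_Rintegral1 P (G := fun z => emp_risk f z.2 z.1)).
  by apply: (bounded_mfun_emp_risk (N := N) Yfin mY mf).
by move=> z; rewrite mulr_ge0 ?invr_ge0 ?sumr_ge0// => i _; rewrite ler0n.
Qed.

Lemma bounded_mfun_riskB : bounded_mfun (fun th => R' th).
Proof. by apply: bounded_mfunB; [exact: bounded_mfun_risk|exact: bounded_mfun_cst]. Qed.

Lemma bounded_mfun_margin : bounded_mfun (fun th => M' th).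
Proof.
apply: (bounded_mfun_Rintegral1 P (G := fun z => emp_margin f z.2 z.1 tht)).
  by apply: (bounded_mfun_emp_margin (N := N) Yfin mY mf).
by move=> z; exact: emp_margin_ge0.
Qed.

(** By Fubini and [exponential_moment], the ratio of the random integral of [expR (F i)] to the
    deterministic one of [expR (F0 i)] has expectation at most 1; [simultaneous_markov] bounds all
    these ratios, and taking logarithms concludes. *)
Lemma log_laplace_deviation (I : finType) (good : pred I)
    (u t s g : I -> R) (eps : R) :
  (0 < N)%N -> (0 < #|I|)%N -> 0 < eps ->
  (forall i, good i ->
    [/\ `|t i| <= g i, 0 <= s i <= 2 * (g i ^+ 2 / N%:R) & g i / N%:R <= 1 / 4]) ->
  exists2 E : set (N.-tuple (X * Y)%type),
    measurable E /\ ((1 - eps)%:E <= P E)%E &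
    forall w, E w -> forall i, good i ->
      log_laplace pi (fun th => - u i * R' th + t i * r' w th + s i * m' w th) <=
      log_laplace pi (fun th => - (u i - t i) * R' th +
                                9 * (g i ^+ 2 / N%:R) * M' th)
      + ln (#|I|%:R / eps).
Proof.
move=> N0 I0 eps0 goodP.
pose F i (z : Theta * N.-tuple (X * Y)) : R :=
  - u i * R' z.1 + t i * r' z.2 z.1 + s i * m' z.2 z.1.
pose F0 i th : R := - (u i - t i) * R' th + 9 * (g i ^+ 2 / N%:R) * M' th.
have bF i : bounded_mfun (F i).
  apply: bounded_mfunD; [apply: bounded_mfunD|]; apply: bounded_mfunZ.
  - have [mR [M hM]] := bounded_mfun_riskB; split; last by exists M => z; exact: hM.
    exact: (measurableT_comp mR measurable_fst).
  - by apply: bounded_mfunB; apply: (bounded_mfun_emp_risk (N := N) Yfin mY mf).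
  - by apply: (bounded_mfun_emp_margin (N := N) Yfin mY mf).
have bF0 i : bounded_mfun (F0 i).
  apply: bounded_mfunD; apply: bounded_mfunZ; first exact: bounded_mfun_riskB.
  exact: bounded_mfun_margin.
have beF i := bounded_mfun_expR (bF i).
have eF0 i z : 0 <= expR (F i z) by exact: expR_ge0.
pose c i := expR (- log_laplace pi (F0 i)).
(* Indices that are not [good] get the value 0, so the moment bound holds for every index while the
   index type stays a full product. *)
pose V i w := if good i then c i * \int[pi]_th expR (F i (th, w)) else 0.
have bV i : bounded_mfun (V i).
  rewrite /V; case: (good i); last exact: bounded_mfun_cst.
  exact/bounded_mfunZ/(bounded_mfun_Rintegral2 _ (beF i)).
have V0 i w : 0 <= V i w.
  rewrite /V; case: ifP => // _; rewrite mulr_ge0 ?expR_ge0//.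
  by apply: Rintegral_ge0 => th _; exact: expR_ge0.
have V1 i : \int[P]_w V i w <= 1.
  rewrite /V; case: (boolP (good i)) => gi; last by rewrite Rintegral_prob_cst.
  have [tg sg gN] := goodP _ gi.
  rewrite RintegralZ_bounded; last exact: (bounded_mfun_Rintegral2 _ (beF i)).
  rewrite /c expRN expR_log_laplace// ler_pdivrMl ?mulr1 ?Rintegral_expR_gt0//.
  rewrite -(Rintegral_swap pi P (beF i))//.
  apply: le_Rintegral_bounded.
  + exact: (bounded_mfun_Rintegral1 _ (beF i)).
  + exact: bounded_mfun_expR.
  + move=> th; rewrite /F /=.
    have br : bounded_mfun (fun w : N.-tuple (X * Y) =>
        t i * r' w th + s i * m' w th : R).
      apply: bounded_mfunD; apply: bounded_mfunZ.
        by apply: bounded_mfunB; apply: (bounded_mfun_emp_risk (N := N) Yfin mY mf).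
      by apply: (bounded_mfun_emp_margin (N := N) Yfin mY mf).
    under eq_Rintegral do rewrite -addrA expRD.
    rewrite RintegralZ_bounded; last exact: bounded_mfun_expR.
    have Ng : g i / N%:R * N%:R = g i by rewrite divfK// pnatr_eq0 -lt0n.
    have Ng2 : (g i / N%:R) ^+ 2 * N%:R = g i ^+ 2 / N%:R.
      by rewrite expr2 -mulrA Ng mulrAC -expr2.
    have := exponential_moment Yfin mY mf tht pP th N0
      (_ : `|t i| <= g i / N%:R * N%:R)
      (_ : 0 <= s i <= 2 * ((g i / N%:R) ^+ 2 * N%:R)) gN.
    rewrite Ng Ng2 => /(_ tg sg) moment.
    apply: (@le_trans _ _ (expR (- u i * R' th) *
      expR (t i * R' th + 9 * (g i ^+ 2 / N%:R) * M' th))).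
      by rewrite ler_pM2l ?expR_gt0.
    by rewrite -expRD /F0 ler_expR le_eqVlt; apply/orP; left; apply/eqP; ring.
have [E PE EV] := simultaneous_markov bV V0 V1 I0 eps0.
exists E => // w Ew i gi.
have := EV w Ew i; rewrite /V gi => cV.
have bFw : bounded_mfun (fun th => F i (th, w)) by exact: bounded_mfun_pair2.
have : expR (log_laplace pi (fun th => F i (th, w)) - log_laplace pi (F0 i)) <=
    #|I|%:R / eps.
  by rewrite expRD mulrC expR_log_laplace.
rewrite -[X in _ <= X -> _]lnK ?posrE ?divr_gt0 ?ltr0n// ler_expR.
by rewrite lerBlDl.
Qed.

End deviation_event.

(** * Gibbs means from deviations *)

(* The exponents (u, t, s) for which the log-Laplace transform of
   - u R' + t r' + s m' has to be controlled, where R', r' and m' are the excess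
   risk, its empirical version and the empirical margin. *)
Definition deviation_params {R : realType} (beta gamma kappa : R) :
    seq (R * R * R) :=
  [:: (0, - (gamma / 4), 0);
      (gamma, gamma / 2, 0);
      (0, - (gamma / 2), kappa);
      (0, - (2 * beta), kappa);
      (4 * beta - gamma, - gamma, 0);
      (2 * beta + gamma, gamma, 0);
      (- (gamma / 4), - (gamma / 2), 0)].

Section localized_gibbs.
Context {R : realType} {d : measure_display} {T : measurableType d}.
Variables (pi : probability T R) (Rx rx mx : T -> R).
Hypotheses (bR : bounded_mfun Rx) (br : bounded_mfun rx) (bm : bounded_mfun mx).
Hypothesis R0 : forall x, 0 <= Rx x.
Variables (beta gamma kappa W Hi Lo : R).
Hypotheses (beta0 : 0 < beta) (beta_gamma : 8 * beta <= gamma).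
Hypothesis gibbsR : forall a, beta <= a ->
  Lo <= a * \int[gibbs pi (fun x => - a * Rx x)]_x Rx x <= Hi.

Local Notation Z a := (log_laplace pi (fun x => - a * Rx x)).
Local Notation z a := (log_laplace pi (fun x => - a * rx x)).
Local Notation dev u t s :=
  (log_laplace pi (fun x => - u * Rx x + t * rx x + s * mx x)).

Hypothesis devP : forall u t s, (u, t, s) \in deviation_params beta gamma kappa ->
  dev u t s <= Z (u - t - beta / 2) + W.

(** Jensen under the Gibbs measure at [a] gives [Z a - Z b <= (b - a) * I], where [I] is the mean of
    [Rx], and [a * I <= Hi]. *)
Lemma log_laplaceB_le a b (k : R) : beta <= a <= b -> b - a <= k * a ->
  Z a - Z b <= k * Hi.
Proof.
move=> /andP[ba ab] bak; have a0 : 0 < a by rewrite (lt_le_trans beta0).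
have /andP[_ IH] := gibbsR ba.
have I0 : 0 <= \int[gibbs pi (fun x => - a * Rx x)]_x Rx x.
  exact: Rintegral_ge0.
have := @gibbs_le_log_laplace _ _ _ pi (fun x => - a * Rx x)
  (fun x => - (b - a) * Rx x) (bounded_mfunZ _ bR) (bounded_mfunZ _ bR).
rewrite (@eq_log_laplace _ _ _ _ _ (fun x => - b * Rx x)); last by move=> x; ring.
rewrite RintegralZ_bounded//.
move: IH I0; move: (Rintegral _ _ _) => I IH I0.
move: (log_laplace _ _) (log_laplace _ _) => Za Zb.
have k0 : 0 <= k by rewrite -(pmulr_lge0 _ a0) (le_trans _ bak)// subr_ge0.
have := ler_wpM2r I0 bak; have := ler_wpM2l k0 IH.
lra.
Qed.

(** Here Jensen is used under the Gibbs measure at the other end, [b]. *)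
Lemma log_laplaceB_ge a b : beta <= a <= b -> (b - a) / b * Lo <= Z a - Z b.
Proof.
move=> /andP[ba ab]; have b0 : 0 < b by rewrite (lt_le_trans beta0) ?(le_trans ba).
have /andP[IL _] := gibbsR (le_trans ba ab).
have := @gibbs_le_log_laplace _ _ _ pi (fun x => - b * Rx x)
  (fun x => (b - a) * Rx x) (bounded_mfunZ _ bR) (bounded_mfunZ _ bR).
rewrite (@eq_log_laplace _ _ _ _ _ (fun x => - a * Rx x)); last by move=> x; ring.
rewrite RintegralZ_bounded//; apply: le_trans.
have := @ler_wpM2l _ ((b - a) / b) _ _ _ IL.
rewrite mulrA divfK ?gt_eqF//; apply.
by rewrite divr_ge0 ?subr_ge0// ltW.
Qed.

Lemma gibbs_upper_ge0 : 0 <= Hi.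
Proof.
have /andP[_] := gibbsR (lexx beta); apply: le_trans.
by rewrite mulr_ge0 ?Rintegral_ge0// ltW.
Qed.

Lemma bounded_mfun_dev u t s : bounded_mfun (fun x => - u * Rx x + t * rx x + s * mx x).
Proof. by apply: bounded_mfunD; [apply: bounded_mfunD|]; exact: bounded_mfunZ. Qed.

Lemma log_laplace_gamma4_le : z (gamma / 4) <= Z (gamma / 4 - beta / 2) + W.
Proof.
have := devP (_ : (0, - (gamma / 4), 0) \in _).
rewrite /deviation_params !inE eqxx ?orbT => /(_ isT).
rewrite (_ : 0 - _ - _ = gamma / 4 - beta / 2); last by ring.
apply: le_trans; rewrite le_eqVlt; apply/orP; left.
by apply/eqP/eq_log_laplace => x; ring.
Qed.

(** This lemma and the next three remove the shift [beta / 2] that the margin term leaves in [devP],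
    at the cost of a multiple of [Hi]; the second also pays for the step from [gamma / 4] to
    [gamma / 2]. *)
Lemma log_laplace_gamma2_shift : Z (gamma / 2 - beta / 2) - Z (gamma / 2) <= 1 / 2 * Hi.
Proof.
have ab : beta <= gamma / 2 - beta / 2 <= gamma / 2.
  by apply/andP; split; move: beta0 beta_gamma; lra.
by apply: (log_laplaceB_le ab); move: beta0 beta_gamma; lra.
Qed.

Lemma log_laplace_gamma4_shift : Z (gamma / 4 - beta / 2) - Z (gamma / 2) <= 2 * Hi.
Proof.
have ab : beta <= gamma / 4 - beta / 2 <= gamma / 2.
  by apply/andP; split; move: beta0 beta_gamma; lra.
by apply: (log_laplaceB_le ab); move: beta0 beta_gamma; lra.
Qed.

Lemma log_laplace_2beta_shift : Z (2 * beta - beta / 2) - Z (2 * beta) <= 1 / 2 * Hi.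
Proof.
have ab : beta <= 2 * beta - beta / 2 <= 2 * beta.
  by apply/andP; split; move: beta0 beta_gamma; lra.
by apply: (log_laplaceB_le ab); move: beta0 beta_gamma; lra.
Qed.

Lemma log_laplace_4beta_shift : Z (4 * beta - beta / 2) - Z (4 * beta) <= 1 / 2 * Hi.
Proof.
have ab : beta <= 4 * beta - beta / 2 <= 4 * beta.
  by apply/andP; split; move: beta0 beta_gamma; lra.
by apply: (log_laplaceB_le ab); move: beta0 beta_gamma; lra.
Qed.

(** Deviations only bound transforms from above; the lower bound comes from convexity, since the
    midpoint of [- (gamma / 2) * rx] and [- gamma * Rx + gamma / 2 * rx] is [- (gamma / 2) * Rx]. *)
Lemma log_laplace_gamma2_ge : Z (gamma / 2) - (1 / 2 * Hi + W) <= z (gamma / 2).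
Proof.
have := devP (_ : (gamma, gamma / 2, 0) \in _).
rewrite /deviation_params !inE eqxx ?orbT => /(_ isT).
rewrite (_ : gamma - _ - _ = gamma / 2 - beta / 2); last by lra.
have := @log_laplace_convex _ _ _ pi (fun x => - (gamma / 2) * rx x)
  (fun x => - gamma * Rx x + gamma / 2 * rx x + 0 * mx x) (1 / 2)
  (bounded_mfunZ _ br) (bounded_mfun_dev _ _ _).
rewrite (@eq_log_laplace _ _ _ _ _ (fun x => - (gamma / 2) * Rx x)); last first.
  by move=> x; field.
have h2 : 0 <= (1 / 2 : R) <= 1 by apply/andP; split; lra.
move=> /(_ h2); move: log_laplace_gamma2_shift.
move: (Z (gamma / 2)) (z (gamma / 2)) (Z (gamma / 2 - beta / 2)) (dev _ _ _) => *.
lra.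
Qed.

(** By Jensen, [gamma / 4] times the mean is at most [z (gamma / 4) - z (gamma / 2)]; comparing the
    two terms with [Z (gamma / 2)] costs [2 * Hi + W] and [1 / 2 * Hi + W], and the total is
    doubled. *)
Lemma gibbs_gamma_emp_risk :
  gamma / 2 * \int[gibbs pi (fun x => - (gamma / 2) * rx x)]_x rx x <=
  5 * Hi + 4 * W.
Proof.
have := @gibbs_le_log_laplace _ _ _ pi (fun x => - (gamma / 2) * rx x)
  (fun x => gamma / 4 * rx x) (bounded_mfunZ _ br) (bounded_mfunZ _ br).
rewrite (@eq_log_laplace _ _ _ _ _ (fun x => - (gamma / 4) * rx x)); last first.
  by move=> x; field.
rewrite RintegralZ_bounded//; move: log_laplace_gamma4_le log_laplace_gamma4_shift.
move: log_laplace_gamma2_ge gibbs_upper_ge0.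
move: (z (gamma / 4)) (z (gamma / 2)) (Z (gamma / 4 - beta / 2)) (Z (gamma / 2)).
move: (Rintegral _ _ _) => *; lra.
Qed.

(** Jensen brings in the mixed exponent [gamma / 4 * Rx - gamma / 2 * rx], one of the
    [deviation_params]; the resulting [5 / 2 * Hi + 2 * W] is multiplied by 4. *)
Lemma gibbs_gamma_risk :
  gamma * \int[gibbs pi (fun x => - (gamma / 2) * rx x)]_x Rx x <=
  10 * Hi + 8 * W.
Proof.
have := devP (_ : (- (gamma / 4), - (gamma / 2), 0) \in _).
rewrite /deviation_params !inE eqxx ?orbT => /(_ isT).
rewrite (_ : - (gamma / 4) - _ - _ = gamma / 4 - beta / 2); last by lra.
have := @gibbs_le_log_laplace _ _ _ pi (fun x => - (gamma / 2) * rx x)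
  (fun x => gamma / 4 * Rx x) (bounded_mfunZ _ br) (bounded_mfunZ _ bR).
rewrite (@eq_log_laplace _ _ _ _ _
  (fun x => - - (gamma / 4) * Rx x + - (gamma / 2) * rx x + 0 * mx x)); last first.
  by move=> x; ring.
rewrite RintegralZ_bounded//.
move: log_laplace_gamma4_shift log_laplace_gamma2_ge gibbs_upper_ge0.
move: (z (gamma / 2)) (Z (gamma / 4 - beta / 2)) (Z (gamma / 2)) (dev _ _ _).
move: (Rintegral _ _ _) => *; lra.
Qed.

Lemma gibbs_gamma_margin :
  log_laplace pi (fun x => - (gamma / 2) * rx x + kappa * mx x) - z (gamma / 2)
  <= Hi + 2 * W.
Proof.
have := devP (_ : (0, - (gamma / 2), kappa) \in _).
rewrite /deviation_params !inE eqxx ?orbT => /(_ isT).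
rewrite (_ : 0 - _ - _ = gamma / 2 - beta / 2); last by ring.
rewrite (@eq_log_laplace _ _ _ _ (fun x => - 0 * Rx x + _ + _)
  (fun x => - (gamma / 2) * rx x + kappa * mx x)); last by move=> x; ring.
move: log_laplace_gamma2_shift log_laplace_gamma2_ge.
move: (z (gamma / 2)) (Z (gamma / 2 - beta / 2)) (Z (gamma / 2)) (log_laplace _ _) => *.
lra.
Qed.

Lemma gamma_gt0 : 0 < gamma. Proof. by move: beta0 beta_gamma; lra. Qed.

(* Convexity turns the deviation at temperature gamma into one at temperature
   2 beta whose error term is smaller by the factor beta / gamma. *)
Lemma log_laplace_2beta_ge :
  gamma * (Z (2 * beta) - z (2 * beta)) <= 2 * beta * (1 / 2 * Hi + W).
Proof.
have := devP (_ : (2 * beta + gamma, gamma, 0) \in _).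
rewrite /deviation_params !inE eqxx ?orbT => /(_ isT).
rewrite (_ : _ - _ - _ = 2 * beta - beta / 2); last by lra.
(* This weight makes the empirical terms cancel, [(1 - q) * (2 * beta) = q * gamma], and leaves
   [- (2 * beta) * Rx]. *)
pose q := 2 * beta / (2 * beta + gamma).
have c0 : 0 < 2 * beta + gamma by move: beta0 gamma_gt0; lra.
have q01 : 0 <= q <= 1.
  rewrite /q divr_ge0 ?ler_pdivrMr//=; move: beta0 gamma_gt0; lra.
have := @log_laplace_convex _ _ _ pi (fun x => - (2 * beta) * rx x)
  (fun x => - (2 * beta + gamma) * Rx x + gamma * rx x + 0 * mx x) q
  (bounded_mfunZ _ br) (bounded_mfun_dev _ _ _) q01.
rewrite (@eq_log_laplace _ _ _ _ _ (fun x => - (2 * beta) * Rx x)); last first.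
  by move=> x; rewrite /q; field; rewrite gt_eqF.
move: log_laplace_2beta_shift.
move: (z (2 * beta)) (Z (2 * beta)) (Z (2 * beta - beta / 2)) (dev _ _ _) => a b c e.
move=> cb + ec; rewrite -(ler_pM2l c0).
rewrite [X in _ <= X -> _](_ : _ = gamma * a + 2 * beta * e); last first.
  by rewrite /q; field; rewrite gt_eqF.
have E : 2 * beta * e <= 2 * beta * (b + 1 / 2 * Hi + W).
  by apply: ler_wpM2l; [rewrite mulr_ge0// ltW|move: cb ec; lra].
move: E; lra.
Qed.

(** Upper counterpart of [log_laplace_2beta_ge]: [- (4 * beta) * rx] is interpolated between
    [- (4 * beta) * Rx] and the exponent containing [- gamma * rx], and the weight
    [4 * beta / gamma] reduces the error. *)
Lemma log_laplace_4beta_le :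
  gamma * (z (4 * beta) - Z (4 * beta)) <= 4 * beta * (1 / 2 * Hi + W).
Proof.
have := devP (_ : (4 * beta - gamma, - gamma, 0) \in _).
rewrite /deviation_params !inE eqxx ?orbT => /(_ isT).
rewrite (_ : _ - _ - _ = 4 * beta - beta / 2); last by lra.
pose q := 4 * beta / gamma.
have gamma0 := gamma_gt0.
have q01 : 0 <= q <= 1.
  rewrite /q divr_ge0 ?ler_pdivrMr//=; move: beta0 gamma_gt0 beta_gamma; lra.
have := @log_laplace_convex _ _ _ pi (fun x => - (4 * beta) * Rx x)
  (fun x => - (4 * beta - gamma) * Rx x + - gamma * rx x + 0 * mx x) q
  (bounded_mfunZ _ bR) (bounded_mfun_dev _ _ _) q01.
rewrite (@eq_log_laplace _ _ _ _ _ (fun x => - (4 * beta) * rx x)); last first.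
  by move=> x; rewrite /q; field; rewrite gt_eqF.
move: log_laplace_4beta_shift.
move: (z (4 * beta)) (Z (4 * beta)) (Z (4 * beta - beta / 2)) (dev _ _ _) => a b c e.
move=> cb + ec; rewrite -(ler_pM2l gamma_gt0).
rewrite [X in _ <= X -> _](_ : _ = gamma * b + 4 * beta * (e - b)); last first.
  by rewrite /q; field; rewrite gt_eqF.
have E : 4 * beta * (e - b) <= 4 * beta * (1 / 2 * Hi + W).
  apply: ler_wpM2l; first by rewrite mulr_ge0 ?ltW.
  by move: cb ec; lra.
move: E; lra.
Qed.

(** Source of the negative term of the bound. Jensen compares [z (2 * beta)] with [z (4 * beta)];
    the difference of the [Z] is at least [1 / 2 * Lo], and the errors, of order [beta / gamma],
    stay bounded after multiplication by [gamma / beta]. *)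
Lemma gibbs_beta_emp_risk :
  gamma / beta * Lo / 8 - 3 / 2 * (1 / 2 * Hi + W) <=
  gamma / 2 * \int[gibbs pi (fun x => - (2 * beta) * rx x)]_x rx x.
Proof.
have := @gibbs_le_log_laplace _ _ _ pi (fun x => - (2 * beta) * rx x)
  (fun x => - (2 * beta) * rx x) (bounded_mfunZ _ br) (bounded_mfunZ _ br).
rewrite (@eq_log_laplace _ _ _ _ _ (fun x => - (4 * beta) * rx x)); last first.
  by move=> x; ring.
rewrite RintegralZ_bounded//.
have := @log_laplaceB_ge (2 * beta) (4 * beta).
rewrite (_ : (4 * beta - 2 * beta) / (4 * beta) = 1 / 2); last first.
  by field; rewrite gt_eqF.
have -> : beta <= 2 * beta <= 4 * beta by move: beta0; lra.
move=> /(_ isT); move: log_laplace_2beta_ge log_laplace_4beta_le.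
move: (z (2 * beta)) (Z (2 * beta)) (z (4 * beta)) (Z (4 * beta)).
move: (Rintegral _ _ _) => I a b c e A B C D.
rewrite -(ler_pM2l (_ : 0 < 4 * beta)) ?mulr_gt0//.
rewrite (_ : 4 * beta * (_ - _) =
  gamma * (1 / 2 * Lo) - 6 * beta * (1 / 2 * Hi + W)); last first.
  by field; rewrite gt_eqF.
have := ler_wpM2l (ltW gamma_gt0) D; have := ler_wpM2l (ltW gamma_gt0) C.
move: A B; lra.
Qed.

Hypothesis W0 : 0 <= W.

Lemma gibbs_beta_margin :
  log_laplace pi (fun x => - (2 * beta) * rx x + kappa * mx x) - z (2 * beta)
  <= Hi + 2 * W.
Proof.
have := devP (_ : (0, - (2 * beta), kappa) \in _).
rewrite /deviation_params !inE eqxx ?orbT => /(_ isT).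
rewrite (_ : 0 - _ - _ = 2 * beta - beta / 2); last by ring.
rewrite (@eq_log_laplace _ _ _ _ (fun x => - 0 * Rx x + _ + _)
  (fun x => - (2 * beta) * rx x + kappa * mx x)); last by move=> x; ring.
have : Z (2 * beta) - z (2 * beta) <= 1 / 2 * Hi + W.
  rewrite -(ler_pM2l gamma_gt0) (le_trans log_laplace_2beta_ge)// ler_wpM2r//.
    by rewrite addr_ge0// mulr_ge0// gibbs_upper_ge0.
  by move: beta0 beta_gamma; lra.
move: log_laplace_2beta_shift.
move: (z (2 * beta)) (Z (2 * beta - beta / 2)) (Z (2 * beta)) (log_laplace _ _).
move=> *; lra.
Qed.

End localized_gibbs.

(** * The empirical bound *)

Section hyperbolic_bounds.
Context {R : realType}.
Implicit Types s x y : R.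

(** With denominators cleared this is [1 + 2 * s <= expR (2 * s)]. *)
Lemma tanh_ge s : 0 <= s -> s / (1 + s) <= tanh s.
Proof.
move=> s0; have s1 : 0 < 1 + s by lra.
rewrite /tanh ler_pdivrMr// mulrAC ler_pdivlMr ?addr_gt0 ?expR_gt0//.
have : (1 + 2 * s) * expR (- s) <= expR s.
  have -> : expR s = expR (2 * s) * expR (- s).
    by rewrite -expRD; congr expR; ring.
  by rewrite ler_pM2r ?expR_gt0// expR_ge1Dx.
by move: (expR s) (expR (- s)) => u v; lra.
Qed.

Lemma cosh_ge1 s : 1 <= cosh s.
Proof.
rewrite /cosh ler_pdivlMr//.
by have := expR_ge1Dx s; have := expR_ge1Dx (- s); lra.
Qed.

Lemma ln_cosh_le s : `|s| <= 1 / 2 -> ln (cosh s) <= 2 * s ^+ 2.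
Proof.
move=> s2; have := expR_le_quadratic s2.
have /expR_le_quadratic : `|- s| <= 1 / 2 by rewrite normrN.
rewrite sqrrN => h1 h2.
apply: (@le_trans _ _ (ln (1 + 2 * s ^+ 2))).
  rewrite ler_ln ?posrE.
  - by rewrite /cosh ler_pdivrMr//; move: h1 h2; lra.
  - by rewrite (lt_le_trans _ (cosh_ge1 s)).
  - by rewrite ltr_pwDl// mulr_ge0// sqr_ge0.
by apply: le_ln1Dx; rewrite (@lt_le_trans _ _ 0)// mulr_ge0// sqr_ge0.
Qed.

(** The constant is [1 / (1 + 1 / 4)], from [tanh_ge]. This bound makes [gamma] and
    [lambda_2 = 2 * beta] admissible later. *)
Lemma mul_tanh_ge (N : nat) (gamma : R) : (0 < N)%N -> 0 < gamma ->
  gamma / N%:R <= 1 / 4 -> 4 / 5 * gamma <= N%:R * tanh (gamma / N%:R).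
Proof.
move=> N0 g0 s4; have N0' : 0 < N%:R :> R by rewrite ltr0n.
set s := gamma / N%:R in s4 *.
have s0 : 0 < s by rewrite divr_gt0.
have -> : gamma = N%:R * s by rewrite /s mulrC divfK// gt_eqF.
rewrite mulrCA ler_pM2l// (le_trans _ (tanh_ge (ltW s0)))//.
by rewrite ler_pdivlMr; [nra|lra].
Qed.

(** As [ln (1 - u) <= - u], [F_fun] at [x] is at least [x] times [N%:R * tanh (gamma / N%:R) - a],
    and [4 / 5 - 1 / 2] exceeds [1 / 4]. *)
Lemma F_inv_le (N : nat) (gamma a y : R) : (0 < N)%N -> 0 < gamma ->
  gamma / N%:R <= 1 / 4 -> a <= gamma / 2 -> 0 <= y ->
  exists2 x : R, F_inv N gamma a y%:E = x%:E & gamma / 4 * x <= y.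
Proof.
move=> N0 g0 s4 ag y0; set t := tanh (gamma / N%:R).
have Nt := mul_tanh_ge N0 g0 s4; rewrite -/t in Nt.
have t0 : 0 < t.
  rewrite -(pmulr_rgt0 _ (_ : 0 < N%:R :> R)) ?ltr0n// (lt_le_trans _ Nt)//.
  by rewrite mulr_gt0.
eexists; first by [].
(* Outside the image of [F_fun] the partial inverse returns 0, and the bound reads [0 <= y]. *)
rewrite /pinv_ splitV oinv_surj; case: pselect => [y_im|_]; last by rewrite mulr0.
case: cid2 => x /= /andP[x0 xt] <-; rewrite /F_fun -/t.
have tx1 : 0 < 1 - t * x.
  by rewrite subr_gt0 -(mulfV (lt0r_neq0 t0)) ltr_pM2l.
have : ln (1 - t * x) <= - (t * x).
  by apply: le_ln1Dx; rewrite ltrNl opprK -subr_gt0.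
have N0' : 0 < N%:R :> R by rewrite ltr0n.
move=> /(ler_wpM2l (ltW N0')); have := ler_wpM2r x0 Nt.
have := ler_wpM2r x0 ag; have : 0 <= gamma * x by rewrite mulr_ge0// ltW.
by rewrite /funin; move: (ln _) => l; move: (N%:R) => n; lra.
Qed.

End hyperbolic_bounds.

(** The factor [expR c] cancels in the normalisation, so risks may be replaced by excess risks in
    Gibbs measures. *)
Lemma Rintegral_gibbs_shift {R : realType} {d : measure_display}
    {T : measurableType d} (mu : probability T R) (h g : T -> R) (c : R) :
  bounded_mfun h -> bounded_mfun g ->
  \int[gibbs mu (fun x => h x + c)]_x g x = \int[gibbs mu h]_x g x.
Proof.
move=> bh bg; have bhc : bounded_mfun (fun x => h x + c).
  by apply: bounded_mfunD => //; exact: bounded_mfun_cst.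
have beh := bounded_mfun_expR bh.
rewrite (Rintegral_gibbs mu bhc bg) (Rintegral_gibbs mu bh bg).
under eq_Rintegral do rewrite expRD mulrA.
rewrite RintegralZr; [|by []|exact/bounded_mfun_integrable/bounded_mfunM].
under [X in _ / X]eq_Rintegral do rewrite expRD.
rewrite RintegralZr; [|by []|exact/bounded_mfun_integrable].
by rewrite invfM mulrACA divff ?mulr1// gt_eqF// expR_gt0.
Qed.

(** * Uniform measure on the grid and size of the penalty *)

Lemma card_grid_le {R : realType} (N : nat) (alpha : R) (n : nat) :
  ln (N%:R : R) / ln alpha <= n%:R ->
  finite_set (grid N alpha) /\ (#|` fset_set (grid N alpha) | <= n)%N.
Proof.
move=> Ln; have cn : (grid N alpha #<= `I_n)%card.
  apply: card_le_trans (card_image_le _ _) _; apply: subset_card_le => k /= kL.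
  by rewrite -(ltr_nat R) (lt_le_trans kL).
split; last exact: geq_card_fset_set.
exact: card_le_finite cn (finite_II n).
Qed.

Lemma grid_uniform_atom {R : realType} (N : nat) (alpha b : R) (n : nat) :
  ln (N%:R : R) / ln alpha <= n%:R -> grid N alpha b ->
  exists2 q : R, grid_uniform N alpha [set b] = q%:E & n%:R^-1 <= q <= 1.
Proof.
move=> Ln gb; have [fin_g card_g] := card_grid_le Ln.
set m := #|` fset_set (grid N alpha)| in card_g.
(* The point [b] shows that the grid is not empty, which rules out the Dirac convention in
   [grid_uniform]. *)
have m0 : (0 < m)%N.
  rewrite cardfs_gt0; apply/fset0Pn; exists b.
  by rewrite in_fset_set// inE.
have cg : counting (grid N alpha) = m%:R%:E :> \bar R by rewrite /counting asboolT.
exists m%:R^-1; last first.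
  rewrite lef_pV2 ?posrE ?ltr0n// ?(leq_trans m0)// ler_nat card_g/=.
  by rewrite invf_le1 ?ltr0n// ler1n.
rewrite /grid_uniform /= /mnormalize /= /mrestr /= setTI cg eqe.
rewrite pnatr_eq0 gtn_eqF//= (_ : [set b] `&` _ = [set b]).
  by rewrite /counting asboolT// fset_set1 cardfs1 mul1e.
by apply/seteqP; split => x /= [] // -> .
Qed.

Lemma penaltyE {R : realType} (N : nat) (alpha eps beta gamma : R) (n : nat) :
  ln (N%:R : R) / ln alpha <= n%:R -> (0 < n)%N -> 0 < eps < 1 ->
  grid N alpha beta -> grid N alpha gamma ->
  exists2 D : R, penalty eps (grid_uniform N alpha) beta gamma = D%:E &
    0 <= D <= ln (n%:R ^+ 2 / eps).
Proof.
move=> Ln n0 /andP[e0 e1] gb gg.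
have [q1 E1 /andP[q1n q1l]] := grid_uniform_atom Ln gb.
have [q2 E2 /andP[q2n q2l]] := grid_uniform_atom Ln gg.
have nV0 : 0 < n%:R^-1 :> R by rewrite invr_gt0 ltr0n.
have q10 : 0 < q1 by exact: lt_le_trans q1n.
have q20 : 0 < q2 by exact: lt_le_trans q2n.
have q0 : 0 < eps * q1 * q2 by rewrite !mulr_gt0.
exists (- ln (eps * q1 * q2)).
  by rewrite /penalty E1 E2 -!EFinM lne_EFin.
have q_le1 : eps * q1 * q2 <= 1.
  by rewrite !mulr_ile1// ?mulr_ge0// ?ltW.
rewrite oppr_ge0 ln_le0//= -lnV ?posrE// ler_ln ?posrE ?invr_gt0//; last first.
  by rewrite divr_gt0// exprn_gt0// ltr0n.
rewrite -[n%:R ^+ 2 / eps]invrK lef_pV2 ?posrE ?invr_gt0 ?divr_gt0 ?exprn_gt0 ?ltr0n//.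
rewrite invfM invrK mulrC expr2 invfM mulrA.
by rewrite -!mulrA ler_pM2l// ler_pM// ltW.
Qed.

(** * Evaluation of the bound at [lambda_1 = gamma / 2] and [lambda_2 = 2 * beta] *)

Section empirical_bound.
Context {R : realType} {dX dY dT : measure_display}.
Context {X : measurableType dX} {Y : measurableType dY}.
Context {Theta : measurableType dT} {N : nat}.
Variable f : Theta -> X -> Y.
Hypothesis Yfin : finite_set [set: Y].
Hypothesis mY : forall C : set Y, measurable C.
Hypothesis mf : measurable_fun [set: Theta * X] (fun z => f z.1 z.2).
Variables (pi : probability Theta R) (w : N.-tuple (X * Y)%type) (tht : Theta).

Local Notation r th := (emp_risk f w th).
Local Notation r' th := (emp_risk f w th - emp_risk f w tht).
Local Notation m' th := (emp_margin f w th tht).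
Local Notation post l := (gibbs pi (fun th => - l * r th)).

Let br : bounded_mfun (fun th => r' th : R).
Proof. exact: bounded_mfun_emp_riskB. Qed.

Let bm : bounded_mfun (fun th => m' th : R).
Proof. exact: bounded_mfun_emp_margin1. Qed.

Let bpost (l : R) : bounded_mfun (fun th => - l * r th : R).
Proof. by apply: bounded_mfunZ; apply: (bounded_mfun_emp_risk Yfin mY mf). Qed.

Lemma Rintegral_post (l : R) (g : Theta -> R) : bounded_mfun g ->
  \int[post l]_th g th = \int[gibbs pi (fun th => - l * r' th)]_th g th.
Proof.
move=> bg; rewrite -(Rintegral_gibbs_shift pi (l * r tht) (bpost l) bg).
by congr (Rintegral (gibbs _ _)); apply/funext => th; ring.
Qed.

Lemma log_laplace_post (l k : R) :
  log_laplace pi (fun th => - l * r th + k * m' th)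
  - log_laplace pi (fun th => - l * r th) =
  log_laplace pi (fun th => - l * r' th + k * m' th)
  - log_laplace pi (fun th => - l * r' th).
Proof.
have b1 : bounded_mfun (fun th => - l * r' th : R) by exact: bounded_mfunZ.
have b2 : bounded_mfun (fun th => - l * r' th + k * m' th : R).
  by apply: bounded_mfunD => //; exact: bounded_mfunZ.
rewrite (@eq_log_laplace _ _ _ _ (fun th => - l * r th + k * m' th)
  (fun th => (- l * r' th + k * m' th) + - l * r tht)); last by move=> th; ring.
rewrite (@eq_log_laplace _ _ _ _ (fun th => - l * r th)
  (fun th => - l * r' th + - l * r tht)); last by move=> th; ring.
rewrite (log_laplaceDc pi _ b2) (log_laplaceDc pi _ b1).
by move: (log_laplace _ _) (log_laplace _ _) => x y; ring.
Qed.

(** The triangle inequality for margins, through [tht], separates the two measures: the first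
    contributes a difference of transforms, the second a Gibbs mean bounded by Jensen. The lower
    bound 0 provides the nonnegative argument that [F_inv_le] asks for. *)
Lemma log_laplace_margin_post (gamma l1 l2 kappa u1 u2 : R) :
  (0 < N)%N -> 0 < gamma -> gamma / N%:R <= 1 / 4 ->
  kappa = 2 * (gamma ^+ 2 / N%:R) ->
  log_laplace pi (fun th => - l1 * r' th + kappa * m' th)
    - log_laplace pi (fun th => - l1 * r' th) <= u1 ->
  log_laplace pi (fun th => - l2 * r' th + kappa * m' th)
    - log_laplace pi (fun th => - l2 * r' th) <= u2 ->
  0 <= log_laplace_margin f w gamma (post l1) (post l2) <= u1 + u2.
Proof.
move=> N0 g0 s4 kappaE; have s2 : gamma / N%:R <= 1 / 2 by lra.
move=> + +; have N0' : 0 < N%:R :> R by rewrite ltr0n.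
rewrite -log_laplace_post => u1P; rewrite -log_laplace_post => u2P.
rewrite /log_laplace_margin.
set c := N%:R * ln (cosh (gamma / N%:R)).
have c0 : 0 <= c by rewrite mulr_ge0 ?ln_ge0 ?cosh_ge1.
have cK : c <= kappa.
  rewrite kappaE /c (_ : 2 * _ = N%:R * (2 * (gamma / N%:R) ^+ 2)).
    by rewrite ler_pM2l// ln_cosh_le// ger0_norm// divr_ge0// ltW.
  by field; rewrite gt_eqF.
have bmm : bounded_mfun (fun z : Theta * Theta => emp_margin f w z.1 z.2 : R).
  by apply: (bounded_mfun_emp_margin Yfin mY mf).
have mm0 (z : Theta * Theta) : 0 <= emp_margin f w z.1 z.2 :> R.
  exact: emp_margin_ge0.
have bmpost : bounded_mfun (fun th => \int[post l2]_th' emp_margin f w th th' : R).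
  exact: (bounded_mfun_Rintegral1 _ bmm mm0).
have bcm : bounded_mfun (fun th => c * \int[post l2]_th' emp_margin f w th th').
  exact: bounded_mfunZ.
have m0 th : 0 <= \int[post l2]_th' emp_margin f w th th' :> R.
  by apply: Rintegral_ge0 => th' _; exact: emp_margin_ge0.
apply/andP; split.
  apply: ln_ge0; rewrite -[leLHS](Rintegral_prob_cst (post l1)).
  apply: le_Rintegral_bounded; [exact: bounded_mfun_cst|exact: bounded_mfun_expR|].
  by move=> th; rewrite -expR0 ler_expR mulr_ge0.
pose I := \int[post l2]_th m' th.
have kappa0 : 0 <= kappa by exact: le_trans cK.
have bkm : bounded_mfun (fun th => kappa * m' th : R) by exact: bounded_mfunZ.
have bkI : bounded_mfun (fun th => kappa * m' th + kappa * I : R).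
  by apply: bounded_mfunD => //; exact: bounded_mfun_cst.
apply: (@le_trans _ _ (ln (\int[post l1]_th expR (kappa * m' th + kappa * I)))).
  rewrite ler_ln ?posrE ?Rintegral_expR_gt0//.
  apply: le_Rintegral_bounded; [exact: bounded_mfun_expR..|] => th.
  rewrite ler_expR -mulrDr; apply: ler_pM => //.
  rewrite -[m' th](Rintegral_prob_cst (post l2)) -RintegralD_bounded//; last first.
    exact: bounded_mfun_cst.
  apply: le_Rintegral_bounded.
  - exact: (bounded_mfun_pair1 bmm).
  - by apply: bounded_mfunD => //; exact: bounded_mfun_cst.
  - by move=> th'; exact: emp_margin_le.
rewrite Rintegral_gibbs_expR//.
rewrite (@eq_log_laplace _ _ _ _ (fun th => _ + (_ + kappa * I))
  (fun th => (- l1 * r th + kappa * m' th) + kappa * I)); last first.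
  by move=> th; rewrite addrA.
rewrite log_laplaceDc; last exact: bounded_mfunD.
rewrite addrAC; apply: lerD => //; apply: le_trans u2P.
rewrite /I -RintegralZ_bounded//; exact: gibbs_le_log_laplace.
Qed.

(** With [lambda_1 = gamma / 2] the divergence is 0; with [lambda_2 = 2 * beta] the parameter [a] of
    [F_inv] is [gamma / 2] and its prefactor is [gamma / 4], as in [F_inv_le]. *)
Lemma B_bound_le0 (eps beta gamma kappa Hi Lo W D : R)
    (nu : probability (measurableTypeR R) R) :
  (0 < N)%N -> 0 < beta -> 8 * beta <= gamma -> gamma / N%:R <= 1 / 4 ->
  kappa = 2 * (gamma ^+ 2 / N%:R) ->
  penalty eps nu beta gamma = D%:E -> 0 <= D <= W ->
  gamma / 2 * \int[gibbs pi (fun th => - (gamma / 2) * r' th)]_th r' th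
    <= 5 * Hi + 4 * W ->
  gamma / beta * Lo / 8 - 3 / 2 * (1 / 2 * Hi + W) <=
    gamma / 2 * \int[gibbs pi (fun th => - (2 * beta) * r' th)]_th r' th ->
  log_laplace pi (fun th => - (gamma / 2) * r' th + kappa * m' th)
    - log_laplace pi (fun th => - (gamma / 2) * r' th) <= Hi + 2 * W ->
  log_laplace pi (fun th => - (2 * beta) * r' th + kappa * m' th)
    - log_laplace pi (fun th => - (2 * beta) * r' th) <= Hi + 2 * W ->
  0 <= Hi -> 128 * (Hi + W) <= gamma / beta * Lo ->
  (B_bound f pi eps nu w (post (gamma / 2)) beta gamma <= 0)%E.
Proof.
move=> N0 beta0 bg s4 kappaE penE /andP[D0 DW].
have gamma0 : 0 < gamma by rewrite (lt_le_trans _ bg)// mulr_gt0.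
have N0' : 0 < N%:R :> R by rewrite ltr0n.
have l1P : 0 <= gamma / 2 <= gamma.
  by rewrite divr_ge0 ?ler_pdivrMr ?ler_peMr ?ler1n// ltW.
have l2P : beta * gamma / N%:R * (tanh (gamma / N%:R))^-1 < 2 * beta.
  have Nt := mul_tanh_ge N0 gamma0 s4.
  set t := tanh _ in Nt *.
  have Nt0 : 0 < N%:R * t by rewrite (lt_le_trans _ Nt)// mulr_gt0.
  rewrite -mulrA -invfM ltr_pdivrMr// -mulrA mulrCA ltr_pM2l//.
  by move: Nt; lra.
have aP : beta * gamma / (2 * beta) <= gamma / 2.
  by rewrite [leLHS](_ : _ = gamma / 2)//; field; rewrite gt_eqF.
have xP (u v c x : R) : (gamma - gamma / 2) * (u + c - (v + c)) =
    gamma / 2 * u - gamma / 2 * v /\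
    (gamma - gamma / 2) * (beta / (2 * beta)) * x = gamma / 4 * x.
  by split; field; rewrite ?gt_eqF.
move=> riskG riskB margG margB Hi0 gain.
apply: (@le_trans _ _ (B_expr f pi eps nu w (post (gamma / 2)) beta gamma
                        (gamma / 2) (2 * beta))).
  apply: ereal_inf_lbound; by exists (gamma / 2, 2 * beta).
have r'B l : \int[post l]_th r th =
    \int[gibbs pi (fun th => - l * r' th)]_th r' th + r tht.
  rewrite -(Rintegral_post l br) RintegralB_bounded.
  - by rewrite Rintegral_prob_cst subrK.
  - by apply: (bounded_mfun_emp_risk Yfin mY mf).
  - exact: bounded_mfun_cst.
have /andP[LG0 LG] := log_laplace_margin_post N0 gamma0 s4 kappaE margG margG.
have /andP[LB0 LB] := log_laplace_margin_post N0 gamma0 s4 kappaE margB margB.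
rewrite /B_expr kullback_refl penE.
rewrite -(EFinD (log_laplace_margin f w gamma (post (2 * beta)) (post (2 * beta)))).
have [x -> xy] := F_inv_le N0 gamma0 s4 aP (addr_ge0 LB0 D0).
rewrite add0e -EFinM -!EFinD lee_fin !r'B.
rewrite (xP _ _ _ x).1 (xP 0 0 0 x).2.
(* The positive terms add up to at most [39 / 4 * Hi + 31 / 2 * W], while [gain] divided by 8
   provides [16 * (Hi + W)]. *)
move: LG LB xy riskG riskB gain.
move: (log_laplace_margin _ _ _ _ _) (log_laplace_margin _ _ _ _ _) => L1 L2.
move: (Rintegral _ _ _) (Rintegral _ _ _) (gamma / beta * Lo).
move: DW D0 Hi0; clear=> *; lra.
Qed.

End empirical_bound.

Lemma deviation_params_bounds {R : realType} (beta gamma kappa : R) q :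
  0 < beta -> 8 * beta <= gamma -> 0 <= kappa ->
  q \in deviation_params beta gamma kappa ->
  `|q.1.2| <= gamma /\ 0 <= q.2 <= kappa.
Proof.
move=> b0 bg k0; rewrite /deviation_params !inE.
have kP : 0 <= kappa <= kappa by rewrite k0 lexx.
have zP : (0 : R) <= 0 <= kappa by rewrite lexx k0.
by do !case/orP; move=> /eqP -> /=; split=> //; rewrite ler_norml; lra.
Qed.

(* For de > 1 the right-hand side of the hypothesis is negative. *)
Lemma margin_ratio_condition {R : realType} (b g d de s : R) :
  0 < b -> 0 < g -> 0 < d -> 0 < de -> de != 1 -> 0 <= s ->
  b / g <= 1 / (128 * ((1 + de) / (1 - de)) + s / ((1 - de) * d)) ->
  de < 1 /\ 128 * ((1 + de) * d) + s <= g / b * ((1 - de) * d).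
Proof.
move=> b0 g0 d0 de0 de1 s0.
have de1' : 1 - de != 0 by rewrite subr_eq0 eq_sym.
have c0 : 0 < 128 * ((1 + de) * d) + s.
  by rewrite ltr_pwDl// !mulr_gt0// addr_gt0.
have -> : 128 * ((1 + de) / (1 - de)) + s / ((1 - de) * d) =
    (128 * ((1 + de) * d) + s) / ((1 - de) * d).
  by field; rewrite de1' gt_eqF.
move: (_ + s) c0 => c c0; rewrite invf_div mul1r => bgc.
have bg0 : 0 < b / g by rewrite divr_gt0.
have de_lt1 : de < 1.
  rewrite -subr_gt0 -(pmulr_lgt0 _ d0) -(pmulr_lgt0 _ (_ : 0 < c^-1)) ?invr_gt0//.
  exact: lt_le_trans bgc.
split=> //; move: bgc; rewrite ler_pdivlMr// => bgc.
have := ler_wpM2l (ltW (divr_gt0 g0 b0)) bgc; rewrite mulrA.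
by rewrite -[X in X <= _](_ : c = _)//; field; rewrite !gt_eqF.
Qed.

(** * Conclusion for a fixed sample and fixed [beta], [gamma] *)

Section conclusion.
Context {R : realType} {dX dY dT : measure_display}.
Context {X : measurableType dX} {Y : measurableType dY}.
Context {Theta : measurableType dT} {N : nat}.
Variable f : Theta -> X -> Y.
Hypothesis N0 : (0 < N)%N.
Hypothesis Yfin : finite_set [set: Y].
Hypothesis mY : forall C : set Y, measurable C.
Hypothesis mf : measurable_fun [set: Theta * X] (fun z => f z.1 z.2).
Variables (P : probability (N.-tuple (X * Y)%type) R) (tht : Theta).
Hypothesis tht_min : risk f P tht = inf (range (risk f P)).
Variable pi : probability Theta R.

Local Notation R' th := (risk f P th - risk f P tht).
Local Notation M' th := (margin f P th tht).

Let bR := bounded_mfun_riskB Yfin mY mf P tht.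
Let bM := bounded_mfun_margin Yfin mY mf P tht.

Lemma riskB_ge0 th : 0 <= R' th.
Proof.
rewrite subr_ge0 tht_min; apply: ge_inf; last by exists th.
exists 0 => _ [th' _ <-]; rewrite mulr_ge0 ?invr_ge0// sumr_ge0// => i _.
by rewrite fine_ge0.
Qed.

Lemma margin_le1 th : M' th <= 1.
Proof.
rewrite /margin -[leRHS](Rintegral_prob_cst P); apply: le_Rintegral_bounded.
- by apply: (bounded_mfun_emp_margin Yfin mY mf).
- exact: bounded_mfun_cst.
- by move=> w; exact: emp_margin_le1.
Qed.

(** The real-valued [sup] is an upper bound once the set is known to be bounded above; here 1 is a
    bound, by [margin_le1] and [riskB_ge0]. *)
Lemma margin_le_margin_fun (x : R) th : 0 <= x ->
  M' th <= x * R' th + margin_fun f P tht x.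
Proof.
move=> x0; rewrite -lerBlDl; apply: ub_le_sup; last by exists th.
exists 1 => _ [th' _ <-]; rewrite lerBlDr (le_trans (margin_le1 th'))//.
by rewrite lerDl mulr_ge0// riskB_ge0.
Qed.

Lemma margin_fun_ge0 (x : R) : 0 <= x -> 0 <= margin_fun f P tht x.
Proof.
move=> x0; have := margin_le_margin_fun tht x0; rewrite subrr mulr0 add0r.
by apply: le_trans; apply: Rintegral_ge0 => w _; exact: emp_margin_ge0.
Qed.

Lemma Rintegral_gibbs_risk (mu : probability Theta R) :
  \int[mu]_th risk f P th = \int[mu]_th R' th + risk f P tht.
Proof.
rewrite RintegralB_bounded ?Rintegral_prob_cst ?subrK//.
  exact: (bounded_mfun_risk Yfin mY mf P).
exact: bounded_mfun_cst.
Qed.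

Lemma Rintegral_gibbs_riskB (a : R) (g : Theta -> R) : bounded_mfun g ->
  \int[gibbs pi (fun th => - a * risk f P th)]_th g th =
  \int[gibbs pi (fun th => - a * R' th)]_th g th.
Proof.
move=> bg; have bRa : bounded_mfun (fun th => - a * risk f P th).
  exact/bounded_mfunZ/(bounded_mfun_risk Yfin mY mf P).
rewrite -(Rintegral_gibbs_shift pi (a * risk f P tht) bRa bg).
by congr (Rintegral (gibbs _ _)); apply/funext => th; ring.
Qed.

Variables (w : N.-tuple (X * Y)%type) (alpha eps beta gamma d delta x D Dp : R).
Local Notation r' th := (emp_risk f w th - emp_risk f w tht).
Local Notation m' th := (emp_margin f w th tht).
Local Notation rho := (gibbs pi (fun th => - (gamma / 2) * emp_risk f w th)).
Local Notation nu := (grid_uniform N alpha).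
Local Notation phi := (margin_fun f P tht x).
Hypotheses (d0 : 0 < d) (delta01 : 0 < delta < 1) (beta0 : 0 < beta) (x0 : 0 < x).
Hypothesis beta_gamma : 8 * beta <= gamma.
Hypothesis gamma_N : gamma / N%:R <= 1 / 4.
Hypothesis gamma_x : 9 * (gamma ^+ 2 / N%:R) * x <= beta / 2.
Hypothesis penE : penalty eps nu beta gamma = Dp%:E.
Hypothesis DpD : 0 <= Dp <= D.
Hypothesis gibbs_dim : forall a : R, beta <= a ->
  `| a / d * (\int[gibbs pi (fun th => - a * risk f P th)]_th risk f P th
              - inf (range (risk f P))) - 1 | <= delta.
Hypothesis gain :
  128 * ((1 + delta) * d + (9 * (gamma ^+ 2 / N%:R) * phi + D)) <=
  gamma / beta * ((1 - delta) * d).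
Hypothesis deviations : forall u t s,
  (u, t, s) \in deviation_params beta gamma (2 * (gamma ^+ 2 / N%:R)) ->
  log_laplace pi (fun th => - u * R' th + t * r' th + s * m' th) <=
  log_laplace pi (fun th => - (u - t) * R' th + 9 * (gamma ^+ 2 / N%:R) * M' th) + D.

(** The two sides serve as [Lo] and [Hi] in the lemmas on localised Gibbs measures. *)
Lemma gibbs_dim_riskB (a : R) : beta <= a ->
  (1 - delta) * d <= a * \int[gibbs pi (fun th => - a * R' th)]_th R' th
  <= (1 + delta) * d.
Proof.
move=> ba; have := gibbs_dim ba.
rewrite Rintegral_gibbs_risk -tht_min addrK Rintegral_gibbs_riskB//.
move: (Rintegral _ _ _) => I; rewrite ler_norml lerBlDr lerBrDr mulrAC.
rewrite ler_pdivlMr// ler_pdivrMr// [- delta + 1]addrC.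
by rewrite [delta + 1]addrC.
Qed.

Lemma catoni_conclusion :
  [/\ (B_bound f pi eps nu w rho beta gamma <= 0)%E,
      (beta%:E <= beta_hat f pi eps nu w rho)%E,
      \int[rho]_th risk f P th
        <= \int[gibbs pi (fun th => - beta * risk f P th)]_th risk f P th &
      \int[gibbs pi (fun th => - beta * risk f P th)]_th risk f P th
        <= inf (range (risk f P)) + (1 + delta) * d / beta].
Proof.
have gamma0 : 0 < gamma by rewrite (lt_le_trans _ beta_gamma)// mulr_gt0.
have br : bounded_mfun (fun th => r' th : R) by exact: bounded_mfun_emp_riskB.
have bm : bounded_mfun (fun th => m' th : R) by exact: bounded_mfun_emp_margin1.
have phi0 : 0 <= phi by exact: margin_fun_ge0 (ltW x0).
have g2N : 0 <= gamma ^+ 2 / N%:R by rewrite divr_ge0// sqr_ge0.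
have gain' := gain; set W := 9 * (gamma ^+ 2 / N%:R) * phi + D in gain'.
have /andP[Dp0 DpD'] := DpD.
have DpW : 0 <= Dp <= W.
  by rewrite Dp0 (le_trans DpD')// lerDr mulr_ge0// mulr_ge0.
have W0 : 0 <= W by case/andP: DpW; exact: le_trans.
have Hi0 : 0 <= (1 + delta) * d.
  by case/andP: delta01 => de0 _; rewrite ltW// mulr_gt0// addr_gt0.
have beta_lt : beta < 4 / 5 * gamma by move: beta0 beta_gamma; lra.
have final I J : gamma * I <= 10 * ((1 + delta) * d) + 8 * W ->
    128 * ((1 + delta) * d + W) <= gamma * J -> gamma * I <= gamma * J.
  by move: Hi0 W0; move: (_ * d) => H ? ? ? ?; lra.
(* The margin is absorbed through [margin_le_margin_fun]: [gamma_x] bounds the resulting multiple of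
   the excess risk by [beta / 2], and the rest enters [W]. *)
have devP u t s : (u, t, s) \in deviation_params beta gamma (2 * (gamma ^+ 2 / N%:R)) ->
    log_laplace pi (fun th => - u * R' th + t * r' th + s * m' th) <=
    log_laplace pi (fun th => - (u - t - beta / 2) * R' th) + W.
  move=> /deviations; move=> /le_trans; apply.
  rewrite /W addrA lerD2r -log_laplaceDc; last exact: bounded_mfunZ.
  apply: le_log_laplace.
  - by apply: bounded_mfunD; exact: bounded_mfunZ.
  - by apply: bounded_mfunD; [exact: bounded_mfunZ|exact: bounded_mfun_cst].
  - move=> th; have := margin_le_margin_fun th (ltW x0).
    have := ler_wpM2r (riskB_ge0 th) gamma_x.
    move=> h1 /(ler_wpM2l (mulr_ge0 (ler0n _ 9) g2N)); move: h1.
    by move: (R' th) (M' th) => A B; rewrite mulrDr mulrA; lra.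
have dimP := gibbs_dim_riskB.
have riskG := gibbs_gamma_emp_risk bR br bm riskB_ge0 beta0 beta_gamma dimP devP.
have riskB := gibbs_beta_emp_risk bR br bm riskB_ge0 beta0 beta_gamma dimP devP.
have margG := gibbs_gamma_margin bR br bm riskB_ge0 beta0 beta_gamma dimP devP.
have margB := gibbs_beta_margin bR br bm riskB_ge0 beta0 beta_gamma dimP devP W0.
have riskGR := gibbs_gamma_risk bR br bm riskB_ge0 beta0 beta_gamma dimP devP.
have B0 := B_bound_le0 Yfin mY mf N0 beta0 beta_gamma gamma_N erefl penE DpW
  riskG riskB margG margB Hi0 gain'.
split=> //.
- apply: ereal_sup_ubound; exists beta => //=.
  apply: le_trans B0; apply: ereal_inf_lbound; exists gamma => //=.
  exact: lt_le_trans beta_lt (mul_tanh_ge N0 gamma0 gamma_N).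
- rewrite !Rintegral_gibbs_risk lerD2r Rintegral_gibbs_riskB//.
  rewrite (Rintegral_post Yfin mY mf pi w tht _ bR).
  have /andP[lower _] := dimP _ (lexx beta).
  (* The comparison of risks is read off from the deviations: [10 * Hi + 8 * W], with
     [Hi = (1 + delta) * d], is below the gain, which is at most [gamma] times the mean excess risk
     at [beta]. *)
  rewrite -(ler_pM2l gamma0); apply: (final _ _ riskGR (le_trans gain' _)).
  by rewrite -mulrA ler_pM2l// ler_pdivrMl.
- rewrite Rintegral_gibbs_risk -tht_min addrC lerD2l Rintegral_gibbs_riskB//.
  by have /andP[_] := dimP _ (lexx beta); rewrite ler_pdivlMr// mulrC.
Qed.

End conclusion.

(** * Logarithmic terms and choice of the constants *)

(** On the grid, [beta < gamma] forces [alpha * beta <= gamma]; since [1 <= beta], the bound on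
    [gamma ^+ 2] then gives [alpha ^+ 2 < N%:R]. This allows [penalty_size] to absorb numerical
    factors in a power of [L]. *)
Lemma grid_ratio_gt2 {R : realType} (N : nat) (alpha beta gamma : R) :
  1 < alpha -> grid N alpha beta -> grid N alpha gamma -> (0 < N)%N ->
  128 * beta <= gamma -> gamma ^+ 2 / N%:R <= 1 / 18 * beta ->
  2 < ln (N%:R : R) / ln alpha.
Proof.
move=> alpha1 [i _ <-] [j _ <-] N0.
set b := alpha ^+ i; set g := alpha ^+ j => bg gN.
have N0' : 0 < N%:R :> R by rewrite ltr0n.
have alpha0 : 0 < alpha by rewrite (lt_trans ltr01).
have b1 : 1 <= b by rewrite exprn_ege1// ltW.
have ij : (i < j)%N.
  by rewrite -(ltr_eXn2l alpha1) -/b -/g; move: bg b1; lra.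
have abg : alpha * b <= g by rewrite /b -exprS ler_eXn2l.
have : alpha ^+ 2 < N%:R.
  move: gN; rewrite ler_pdivrMr// => gN.
  have ab0 : 0 <= alpha * b by rewrite mulr_ge0 ?ltW// (lt_le_trans ltr01).
  have : (alpha * b) ^+ 2 <= g ^+ 2 by rewrite lerXn2r// nnegrE// (le_trans ab0).
  rewrite exprMn [b ^+ 2]expr2 mulrA => /le_trans/(_ gN).
  rewrite [X in _ <= X -> _]mulrAC ler_pM2r ?(lt_le_trans ltr01)// => a2.
  apply: (@le_lt_trans _ _ (1 / 18 * N%:R)); last by lra.
  by apply: le_trans a2; rewrite ler_peMr// sqr_ge0.
move=> a2N; rewrite ltr_pdivlMr ?ln_gt0// mulr_natl -lnXn//.
by rewrite ltr_ln// posrE// exprn_gt0.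
Qed.

(** For [L > 2], [7 <= L ^+ 3] and [n%:R <= L + 1 <= L ^+ 2], whence [7 * n%:R ^+ 2 <= L ^+ 7]. *)
Lemma penalty_size {R : realType} (L eps : R) (n : nat) :
  2 < L -> 0 < eps < 1 -> n%:R <= L + 1 -> (0 < n)%N ->
  ln (7 * n%:R ^+ 2 / eps) <= 7 * ln L - ln eps.
Proof.
move=> L2 /andP[e0 e1] nL n0; have L0 : 0 < L by lra.
have n0' : 0 < n%:R :> R by rewrite ltr0n.
rewrite lnM ?posrE ?invr_gt0 ?mulr_gt0 ?exprn_gt0// lnV// lerD2r.
rewrite [leRHS]mulr_natl -lnXn// ler_ln ?posrE ?mulr_gt0 ?exprn_gt0//.
have nL2 : n%:R <= L ^+ 2 by rewrite (le_trans nL)//; nra.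
have L38 : 8 <= L ^+ 3.
  rewrite (_ : 8 = 2 ^+ 3); last by rewrite -natrX.
  by rewrite lerXn2r ?nnegrE ?ltW.
rewrite (_ : L ^+ 7 = L ^+ 3 * (L ^+ 2) ^+ 2); last by rewrite -exprM -exprD.
have nn0 : 0 <= n%:R :> R by rewrite ler0n.
apply: ler_pM; [exact: ler0n|exact: exprn_ge0| |].
  by rewrite (le_trans _ L38)// ler_nat.
by rewrite lerXn2r ?nnegrE// (le_trans nn0).
Qed.

Theorem theorem2p1p15 (R : realType) :
  exists A B1 B2 B3 B4 : R,
  [/\ 0 < A, 0 < B1, 0 < B2, 0 < B3 & 0 < B4] /\
  forall (N : nat) (dX dY dT : measure_display)
    (X : measurableType dX) (Y : measurableType dY)
    (Theta : measurableType dT) (f : Theta -> X -> Y)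
    (p : 'I_N -> probability (X * Y)%type R)
    (P : probability (N.-tuple (X * Y)%type) R)
    (tht : Theta) (alpha d delta : R)
    (pi : probability Theta R) (eps : R),
  (0 < N)%N ->
  finite_set [set: Y] ->
  (forall C : set Y, measurable C) ->
  measurable_fun [set: Theta * X] (fun z => f z.1 z.2) ->
  is_product_measure p P ->
  risk f P tht = inf (range (risk f P)) ->
  1 < alpha -> alpha <= N%:R ->
  0 < d -> 0 < delta -> delta != 1 ->
  0 < eps < 1 ->
  exists2 E : set (N.-tuple (X * Y)%type),
    measurable E /\ ((1 - eps)%:E <= P E)%E &
    forall w, E w -> forall beta gamma : R,
      grid N alpha beta -> grid N alpha gamma ->
      (ereal_sup [set `| beta' / d *
                         (\int[gibbs pi (fun th => - beta' * risk f P th)]_th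
                            risk f P th
                          - inf (range (risk f P))) - 1 |%:E
                 | beta' in [set b : R | (beta <= b)%R]] <= delta%:E)%E ->
      (exists x : R,
        [/\ 0 < x,
            gamma * Num.max x 1 / N%:R <= A * beta / gamma &
            beta / gamma <=
              B1 / (B2 * ((1 + delta) / (1 - delta))
                    + (B4 * (gamma ^+ 2 / N%:R) * margin_fun f P tht x
                       - 2 * B3 * ln eps
                       + 4 * B3 * ln (ln N%:R / ln alpha))
                      / ((1 - delta) * d))]) ->
      let rho := gibbs pi (fun th => - (gamma / 2) * emp_risk f w th) in
      let nu := grid_uniform N alpha in
      [/\ (B_bound f pi eps nu w rho beta gamma <= 0)%E,
          (beta%:E <= beta_hat f pi eps nu w rho)%E,
          \int[rho]_th risk f P th
            <= \int[gibbs pi (fun th => - beta * risk f P th)]_th risk f P th &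
          \int[gibbs pi (fun th => - beta * risk f P th)]_th risk f P th
            <= inf (range (risk f P)) + (1 + delta) * d / beta].
Proof.
(* [A = 1 / 18] yields [gamma_x], since 9 / 18 = 1 / 2. The gain required by [B_bound_le0] is 128,
   [B4] is 128 times 9, and with [B3 = 256] the coefficients [2 * B3] and [4 * B3] exceed 128 and
   128 times 7, the multiples coming from [penalty_size]. *)
exists (1 / 18), 1, 128, 256, 1152; split; first by split; lra.
move=> N dX dY dT X Y Theta f p P tht alpha d delta pi eps N0 Yfin mY mf pP.
move=> tht_min alpha1 alphaN d0 delta0 delta1 eps01.
have /andP[eps0 eps1] := eps01.
have [L LE] : exists L, ln (N%:R : R) / ln alpha = L by eexists.
have lalpha0 : 0 < ln alpha by rewrite ln_gt0.
(* From [alpha <= N%:R]; it makes [ln L] nonnegative. *)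
have L1 : 1 <= L.
  by rewrite -LE ler_pdivlMr// mul1r ler_ln ?posrE ?ltr0n// (lt_trans ltr01).
(* This [n] strictly exceeds [L], so all exponents of the grid are below it, and it is at most
   [L + 1]. *)
pose n := (Num.truncn L).+1.
have Ln : ln (N%:R : R) / ln alpha <= n%:R by rewrite LE ltW// truncnS_gt.
have nL : n%:R <= L + 1.
  by rewrite /n -natr1 lerD2r truncn_le (le_trans ler01).
(* The event must not depend on [beta] and [gamma]: the index runs over all pairs of exponents and
   the seven deviation parameters, which costs a factor [7 * n%:R ^+ 2]. *)
pose param (i : 'I_n * 'I_n * 'I_7) : R * R * R :=
  nth (0, 0, 0) (deviation_params (alpha ^+ i.1.1) (alpha ^+ i.1.2)
    (2 * ((alpha ^+ i.1.2) ^+ 2 / N%:R))) i.2.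
pose good (i : 'I_n * 'I_n * 'I_7) : bool :=
  (8 * alpha ^+ i.1.1 <= alpha ^+ i.1.2) && (alpha ^+ i.1.2 / N%:R <= 1 / 4).
have alpha0 : 0 < alpha by rewrite (lt_trans ltr01).
have cardI : #|{: 'I_n * 'I_n * 'I_7}| = (n * n * 7)%N.
  by rewrite !card_prod !card_ord.
have goodP i : good i -> [/\ `|(param i).1.2| <= alpha ^+ i.1.2,
    0 <= (param i).2 <= 2 * ((alpha ^+ i.1.2) ^+ 2 / N%:R) &
    alpha ^+ i.1.2 / N%:R <= 1 / 4].
  move=> /andP[bg gN]; have kappa0 : 0 <= 2 * ((alpha ^+ i.1.2) ^+ 2 / N%:R).
    by rewrite mulr_ge0// divr_ge0// sqr_ge0.
  have pin : param i \in deviation_params (alpha ^+ i.1.1) (alpha ^+ i.1.2)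
      (2 * ((alpha ^+ i.1.2) ^+ 2 / N%:R)).
    by apply: mem_nth; exact: ltn_ord.
  by have [] := deviation_params_bounds (exprn_gt0 _ alpha0) bg kappa0 pin; split.
have I0 : (0 < #|{: 'I_n * 'I_n * 'I_7}|)%N by rewrite cardI !muln_gt0.
have [E PE EP] := log_laplace_deviation Yfin mY mf tht pP pi
  (fun i => (param i).1.1) (t := fun i => (param i).1.2)
  (s := fun i => (param i).2) (g := fun i => alpha ^+ i.1.2) N0 I0 eps0 goodP.
exists E => //; rewrite LE => w Ew beta gamma gb gg dimP [x [x0 gN ratio]] rho nu.
have lnL0 : 0 <= ln L by exact: ln_ge0.
have lneps0 : ln eps <= 0 by rewrite ln_le0// ltW.
have [beta0 gamma0] : 0 < beta /\ 0 < gamma.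
  by case: gb => i _ <-; case: gg => j _ <-; rewrite !exprn_gt0.
have phi0 : 0 <= margin_fun f P tht x.
  exact: (margin_fun_ge0 Yfin mY mf tht_min (ltW x0)).
have g2N0 : 0 <= gamma ^+ 2 / N%:R by rewrite divr_ge0// sqr_ge0.
have S0 : 0 <= 1152 * (gamma ^+ 2 / N%:R) * margin_fun f P tht x
    - 2 * 256 * ln eps + 4 * 256 * ln L.
  have : 0 <= 1152 * (gamma ^+ 2 / N%:R) * margin_fun f P tht x.
    by apply: mulr_ge0 phi0; apply: mulr_ge0 g2N0; exact: ler0n.
  have pos (u v l : R) : 0 <= u -> v <= 0 -> 0 <= l ->
      0 <= u - 2 * 256 * v + 4 * 256 * l by clear=> *; lra.
  by move=> h; exact: pos h lneps0 lnL0.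
have [delta_lt1 gain] := margin_ratio_condition beta0 gamma0 d0 delta0 delta1 S0 ratio.
(* [gain] bounds [128 * Hi] by [gamma / beta * Lo], and [Lo <= Hi], with [Hi = (1 + delta) * d] and
   [Lo = (1 - delta) * d]. *)
have bg128 : 128 * beta <= gamma.
  have Hi0 : 0 < (1 + delta) * d by rewrite mulr_gt0// addr_gt0.
  have LoHi : (1 - delta) * d <= (1 + delta) * d.
    by rewrite ler_pM2r//; move: delta0; clear; lra.
  have : 128 * ((1 + delta) * d) <= gamma / beta * ((1 + delta) * d).
    apply: le_trans (ler_wpM2l (ltW (divr_gt0 gamma0 beta0)) LoHi).
    by apply: le_trans gain; rewrite lerDl.
  by rewrite ler_pM2r// ler_pdivlMr.
have N0' : 0 < N%:R :> R by rewrite ltr0n.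
have g2x : gamma ^+ 2 / N%:R * Num.max x 1 <= 1 / 18 * beta.
  move: gN; rewrite ler_pdivlMr//.
  by rewrite (_ : _ / N%:R * gamma = gamma ^+ 2 / N%:R * Num.max x 1)//; ring.
have g2N : gamma ^+ 2 / N%:R <= 1 / 18 * beta.
  by apply: le_trans g2x; rewrite ler_peMr// le_max lexx orbT.
have g2Nx : 9 * (gamma ^+ 2 / N%:R) * x <= beta / 2.
  have scale (k : R) : k * x <= 1 / 18 * beta -> 9 * k * x <= beta / 2.
    by clear=> ?; lra.
  by apply/scale/(le_trans _ g2x); rewrite ler_wpM2l// le_max lexx.
(* Multiplied by [gamma], this follows from [g2N] and [1 / 18 * beta <= gamma / 4]. *)
have gN4 : gamma / N%:R <= 1 / 4.
  rewrite -(ler_pM2l gamma0) mulrA -expr2 (le_trans g2N)//.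
  by move: bg128 beta0; clear; lra.
have L2 : 2 < L by rewrite -LE; exact: (grid_ratio_gt2 alpha1 gb gg).
have D_le := penalty_size L2 eps01 nL (ltn0Sn _).
have [Dp penE /andP[Dp0 DpD]] := penaltyE Ln (ltn0Sn _) eps01 gb gg.
(* One [D] serves both for the deviations and for the penalty, which is at most
   [ln (n%:R ^+ 2 / eps)]. *)
pose D := ln (7 * n%:R ^+ 2 / eps).
have DpD' : 0 <= Dp <= D.
  rewrite Dp0 (le_trans DpD)// ler_ln ?posrE ?divr_gt0 ?mulr_gt0 ?exprn_gt0 ?ltr0n//.
  rewrite ler_pM2r ?invr_gt0// ler_peMl ?ler1n// exprn_ge0//.
have bg8 : 8 * beta <= gamma by move: bg128 beta0; clear; lra.
apply: (@catoni_conclusion R dX dY dT X Y Theta N f N0 Yfin mY mf P tht tht_min pi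
  w alpha eps beta gamma d delta x D Dp) => //.
- by rewrite delta0.
- move=> a ba; rewrite -lee_fin; apply: le_trans dimP.
  by apply: ereal_sup_ubound; exists a.
(* After the factor 128, the required [896 * ln L - 128 * ln eps] is within the available
   [1024 * ln L - 512 * ln eps]. *)
- apply: le_trans gain; move: D_le lneps0 lnL0; rewrite -/D.
  move: (D) (ln eps) (ln L) (_ * d) (_ / N%:R) (margin_fun _ _ _ _).
  by clear=> *; lra.
- move=> u t s uts.
  have [[i iL Ei] [j jL Ej]] := (gb, gg).
  have iN : (i < n)%N by rewrite -(ltr_nat R) (lt_le_trans iL).
  have jN : (j < n)%N by rewrite -(ltr_nat R) (lt_le_trans jL).
  have k7 := uts; rewrite -index_mem in k7.
  pose I := (Ordinal iN, Ordinal jN, Ordinal k7 : 'I_7).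
  have parE : param I = (u, t, s) by rewrite /param /= Ei Ej nth_index.
  have := EP w Ew I; rewrite parE /= Ej cardI.
  rewrite (_ : (n * n * 7)%:R = 7 * n%:R ^+ 2 :> R); last first.
    by rewrite !natrM -expr2 mulrC.
  by apply; rewrite /good /= Ei Ej bg8.
Qed.
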